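(* Let $A$ be a unital $C^*$-algebra, let $\mathcal{H}$ and $\mathcal{K}$ be its universal and standard bimodules, and let $t^A_u, t^A_c, t^A_s\in[0,+\infty]$ be the Kazhdan constants of $A$ defined in the context. (a) The following statements are equivalent. (i) $t^A_u>0$. (ii) $A$ has strong property $(T)$. (iii) There exist a non-empty finite set $Q\subseteq A$ and $\delta>0$ such that for any $\xi\in V_{\mathcal{H}}(Q,\delta)$ we have $P^A_{\mathcal{H}}(\xi)\neq 0$. (b) The following statements are equivalent. (i) $t^A_s>0$. (ii) For any $\epsilon>0$ there exist a non-empty finite set $Q\subseteq A$ and $\delta>0$ such that for any quasi-standard bimodule $H$ over $A$ and any $\xi\in V_H(Q,\delta)$, we have $\|\xi-P^A_H(\xi)\|<\epsilon$. (iii) There exist a non-empty finite set $Q\subseteq A$ and $\delta>0$ such that for any $\xi\in V_{\mathcal{K}}(Q,\delta)$ we have $P^A_{\mathcal{K}}(\xi)\neq 0$. (c) The following statements are equivalent. (i) $t^A_c>0$. (ii) $A$ has property $(T)$. (iii) There exist a non-empty finite set $Q\subseteq A$ and $\delta>0$ such that $V_H(Q,\delta)\cap H_{\mathcal{C}}^\perp=\emptyset$ for any unital Hilbert bimodule $H$ over $A$. (iv) There exist a non-empty finite set $Q\subseteq A$ and $\delta>0$ such that $V_{\mathcal{H}}(Q,\delta)\cap \mathcal{H}_{\mathcal{C}}^\perp=\emptyset$. (d) $t^A_u>0$ if and only if both $t^A_c>0$ and $t^A_s>0$.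
   Context: Let $A^{\rm op}$ be the opposite $C^*$-algebra ($a^{\rm op}b^{\rm op}=(ba)^{\rm op}$) and $A^{Dou}:=A\otimes_{\max}A^{\rm op}$. A unital Hilbert bimodule over $A$ is a Hilbert space $H$ with commuting unital left and right actions of $A$ coming from a non-degenerate $*$-representation of $A^{Dou}$, with $(a\otimes b^{\rm op})\xi=a\cdot\xi\cdot b$. For such $H$: - $H^A:=\{\xi\in H: a\cdot\xi=\xi\cdot a \text{ for all } a\in A\}$ (central vectors), $P^A_H:H\to H^A$ is the orthogonal projection; - for a non-empty finite $Q\subseteq A$ and $\beta>0$, $V_H(Q,\beta):=\{\xi\in H:\|\xi\|=1,\ \|x\cdot\xi-\xi\cdot x\|<\beta \text{ for all }x\in Q\}$; - $H_{\mathcal{C}}$ is the closed sub-bimodule of $H$ generated by $H^A$, and $H_{\mathcal{C}}^\perp$ is its orthogonal complement in $H$. $A$ has property $(T)$ if there exist a non-empty finite $F\subseteq A$ and $\epsilon>0$ such that for any unital Hilbert bimodule $H$ over $A$, $V_H(F,\epsilon)\neq\emptyset$ implies $H^A\neq\{0\}$. $A$ has strong property $(T)$ if for any $\alpha>0$ there exist a non-empty finite $Q\subseteq A$ and $\beta>0$ such that for any unital Hilbert bimodule $H$ over $A$ and any $\xi\in V_H(Q,\beta)$, $\|\xi-P^A_H(\xi)\|<\alpha$. For a state $\tau$ of $A^{Dou}$, $M_\tau$ denotes its GNS representation, viewed as a bimodule over $A$. For a tracial state $\tau$ of $A$, $M_\tau$ denotes the GNS space of $\tau$, viewed as a bimodule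 over $A$ via left and right multiplication. $S(A^{Dou})$ is the state space of $A^{Dou}$ and $S_t(A)$ is the set of tracial states of $A$. The universal bimodule is $\mathcal{H}:=\bigoplus_{\tau\in S(A^{Dou})}M_\tau$ and the standard bimodule is $\mathcal{K}:=\bigoplus_{\tau\in S_t(A)}M_\tau$. A quasi-standard bimodule is one (up to unitary equivalence) of the form $\bigoplus_{\tau\in S_t(A)}M_{\tau,\alpha_\tau}$, where each $\alpha_\tau$ is a cardinal (possibly $0$) and $M_{\tau,\alpha}$ is the direct sum of $\alpha$ copies of $M_\tau$ (zero if $\alpha=0$). For a unital Hilbert bimodule $H$ over $A$, a closed subspace $K\subseteq H$ and a non-empty finite $Q\subseteq A$, put $$t^A(Q;H,K):=\inf\Big\{\Big(\sum_{x\in Q}\|x\cdot\xi-\xi\cdot x\|^2\Big)^{1/2}:\xi\in H\ominus K,\ \|\xi\|=1\Big\},$$ with $\inf\emptyset=+\infty$. Define $t^A_u(Q):=t^A(Q;\mathcal{H},\mathcal{H}^A)$, $t^A_c(Q):=t^A(Q;\mathcal{H},\mathcal{H}_{\mathcal{C}})$, $t^A_s(Q):=t^A(Q;\mathcal{K},\mathcal{K}^A)$, and let $t^A_u,t^A_c,t^A_s$ be the suprema of these quantities over all non-empty finite $Q\subseteq A$. *)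

(* Defs.v *)
From HB Require Import structures.
From mathcomp Require Import all_boot all_order all_algebra.
From mathcomp Require Import sesquilinear complex finmap.
From mathcomp Require Import all_classical all_reals.
From mathcomp Require Import ereal topology normedtype.

Set Implicit Arguments.
Unset Strict Implicit.
Unset Printing Implicit Defensive.

Import Order.TTheory GRing.Theory Num.Theory.
Import numFieldNormedType.Exports.

Local Open Scope classical_set_scope.
Local Open Scope complex_scope.
Local Open Scope ring_scope.

(* The norm of a C*-algebra is a separate field with values in R: MathComp has
   no join of the normed module and the ring hierarchies.  Its topology is only
   used through completeness and through density in is_max_tensor. *)
HB.mixin Record isCStar (R : realType) A of GRing.Algebra R[i] A := {
  star : A -> A ;
  cnorm : A -> R ;
  starK : involutive star ;
  starD : {morph star : x y / x + y} ;
  starZ : forall (a : R[i]) x, star (a *: x) = Num.conj a *: star x ;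
  starM : forall x y, star (x * y) = star y * star x ;
  cnorm_eq0 : forall x, cnorm x = 0 -> x = 0 ;
  cnormD : forall x y, cnorm (x + y) <= cnorm x + cnorm y ;
  cnormZ : forall (a : R[i]) x, cnorm (a *: x) = complex.Re `|a| * cnorm x ;
  cnormM : forall x y, cnorm (x * y) <= cnorm x * cnorm y ;
  cnorm_star : forall x, cnorm (star x * x) = cnorm x ^+ 2 ;
  cnorm_complete : forall u : nat -> A,
    (forall e : R, 0 < e -> exists N, forall m n,
       (N <= m)%N -> (N <= n)%N -> cnorm (u m - u n) < e) ->
    exists l : A, forall e : R, 0 < e -> exists N, forall n,
       (N <= n)%N -> cnorm (u n - l) < e
}.

#[short(type="cstarType")]
HB.structure Definition CStar (R : realType) :=
  {A of GRing.Algebra R[i] A & isCStar R A}.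

(* The opposite C*-algebra, on MathComp's converse ring A^c. *)
Section Opposite.
Variables (R : realType) (A : cstarType R).

HB.instance Definition _ := GRing.Lmodule.copy A^c A.

HB.instance Definition _ :=
  GRing.Lmodule_isLalgebra.Build R[i] A^c (fun a x y => @scalerAr R[i] A a y x).

HB.instance Definition _ :=
  GRing.Lalgebra_isAlgebra.Build R[i] A^c (fun a x y => @scalerAl R[i] A a y x).

Let opp_star : A^c -> A^c := @star R A.
Let opp_cnorm : A^c -> R := @cnorm R A.

Fact cnorm_starr (x : A) : cnorm (star x) = cnorm x.
Proof.
have cnorm_ge0 (y : A) : 0 <= cnorm y.
  have /eqP c0 : cnorm (0 : A) == 0.
    by rewrite -(scale0r (0 : A)) cnormZ normr0 mul0r.
  have := cnormD y (- y); rewrite subrr c0 -scaleN1r cnormZ normrN1 mul1r.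
  by rewrite -mulr2n pmulrn_lge0.
have le_star (y : A) : cnorm y <= cnorm (star y).
  have [y0|y0] := eqVneq (cnorm y) 0; first by rewrite y0.
  rewrite -(ler_pM2r (_ : 0 < cnorm y)) ?lt0r ?y0 ?cnorm_ge0 //.
  by rewrite -expr2 -cnorm_star cnormM.
by apply/eqP; rewrite eq_le le_star andbT -{2}(starK x) le_star.
Qed.

Fact opp_starM (x y : A^c) : opp_star (x * y) = opp_star y * opp_star x.
Proof. exact: (@starM R A). Qed.

Fact opp_cnormM (x y : A^c) : opp_cnorm (x * y) <= opp_cnorm x * opp_cnorm y.
Proof. by rewrite mulrC; exact: (@cnormM R A). Qed.

Fact opp_cnorm_star (x : A^c) :
  opp_cnorm (opp_star x * x) = opp_cnorm x ^+ 2.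
Proof.
by rewrite -[RHS](congr1 (fun t => t ^+ 2) (cnorm_starr x)) -(@cnorm_star R A)
  starK.
Qed.

HB.instance Definition _ := isCStar.Build R A^c
  (@starK R A) (@starD R A) (@starZ R A) opp_starM (@cnorm_eq0 R A)
  (@cnormD R A) (@cnormZ R A) opp_cnormM opp_cnorm_star (@cnorm_complete R A).

End Opposite.

Lemma lrmorph_converseM (R : realType) (A : cstarType R) (B : lalgType R[i])
    (f : {lrmorphism A^c -> B}) (a b : A) : f (a * b) = f b * f a.
Proof. by rewrite -(rmorphM f). Qed.

Definition star_morph (R : realType) (A B : cstarType R) (f : A -> B) :=
  forall a, f (star a) = star (f a).

(* (D, l, r) is the maximal tensor product of A and B, with
   l a = a (x) 1 and r b = 1 (x) b: the algebraic tensor product is dense in D,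
   and commuting unital *-homomorphisms of A and B into a unital C*-algebra E
   extend to D. *)
Definition is_max_tensor (R : realType) (A B D : cstarType R)
    (l : {lrmorphism A -> D}) (r : {lrmorphism B -> D}) : Prop :=
  [/\ star_morph l /\ star_morph r,
      forall a b, l a * r b = r b * l a,
      forall (d : D) (e : R), 0 < e ->
        exists n (a : 'I_n -> A) (b : 'I_n -> B),
          cnorm (d - \sum_(i < n) l (a i) * r (b i)) < e
    & forall (E : cstarType R)
        (f : {lrmorphism A -> E}) (g : {lrmorphism B -> E}),
        star_morph f -> star_morph g ->
        (forall a b, f a * g b = g b * f a) ->
        exists h : {lrmorphism D -> E},
          [/\ star_morph h, forall a, h (l a) = f a
            & forall b, h (r b) = g b]].

(* A^Dou, the maximal tensor product of A and its opposite: dou_l a = a (x) 1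
   and dou_r b = 1 (x) b^op.  It is determined up to isomorphism. *)
Record cstar_double (R : realType) (A : cstarType R) := CStarDouble {
  dou :> cstarType R ;
  dou_l : {lrmorphism A -> dou} ;
  dou_r : {lrmorphism A^c -> dou} ;
  dou_max_tensor : is_max_tensor dou_l dou_r
}.

(* inner is linear in its first argument and conjugate-linear in the second. *)
HB.mixin Record isHilbert (R : realType) H of CompleteNormedModule R[i] H := {
  inner : {dot H for Num.conj} ;
  norm_inner : forall x : H, `|x| ^+ 2 = inner x x
}.

#[short(type="hilbertType")]
HB.structure Definition Hilbert (R : realType) :=
  {H of CompleteNormedModule R[i] H & isHilbert R H}.

(* The norm of H takes its (real) values in R[i]. *)
Definition hnorm (R : realType) (H : hilbertType R) (xi : H) : R :=
  complex.Re `|xi|.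

Definition subspace (R : realType) (H : hilbertType R) (S : set H) : Prop :=
  S 0 /\ forall (a : R[i]) xi eta, S xi -> S eta -> S (a *: xi + eta).

(* The orthogonal projection of xi onto a closed subspace S. *)
Definition orth_proj (R : realType) (H : hilbertType R) (S : set H) (xi : H)
    : H :=
  xget 0 [set p | S p /\ forall eta, S eta -> inner (xi - p) eta = 0].

Definition orth_compl (R : realType) (H : hilbertType R) (S : set H) : set H :=
  [set xi | forall eta, S eta -> inner xi eta = 0].

(* A unital Hilbert bimodule over A, as a unital (that is, non-degenerate)
   *-representation of A^Dou by bounded operators. *)
Record bimodule (R : realType) (A : cstarType R) (D : cstar_double A) := Bimodule {
  bim :> hilbertType R ;
  rep : D -> bim -> bim ;
  rep_linear : forall d, linear (rep d) ;
  rep_continuous : forall d, continuous (rep d) ;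
  rep_linearl : forall xi, linear (rep^~ xi) ;
  repM : forall d d' xi, rep (d * d') xi = rep d (rep d' xi) ;
  rep1 : forall xi, rep 1 xi = xi ;
  rep_star : forall d xi eta, inner (rep d xi) eta = inner xi (rep (star d) eta)
}.

Section Bimodules.
Variables (R : realType) (A : cstarType R) (D : cstar_double A).
Implicit Types (H : bimodule D) (Q : {fset A}).

Definition lact H (a : A) (xi : H) : H := rep (dou_l D a) xi.
Definition ract H (xi : H) (b : A) : H := rep (dou_r D b) xi.

Definition central H : set H :=
  [set xi | forall a : A, lact a xi = ract xi a].
Arguments central : clear implicits.

Definition proj_central H (xi : H) : H := orth_proj (central H) xi.

Definition almost_central H Q (beta : R) : set H :=
  [set xi | hnorm xi = 1 /\
     forall x, x \in Q -> hnorm (lact x xi - ract xi x) < beta].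
Arguments almost_central : clear implicits.

Definition subbimodule H (S : set H) : Prop :=
  subspace S /\
  forall (a : A) xi, S xi -> S (lact a xi) /\ S (ract xi a).

Definition central_span H : set H :=
  [set xi | forall S : set H, subbimodule S -> closed S ->
     central H `<=` S -> S xi].
Arguments central_span : clear implicits.

Definition property_T : Prop :=
  exists (F : {fset A}) (eps : R), [/\ F != fset0, 0 < eps &
    forall H, almost_central H F eps !=set0 ->
      exists xi, central H xi /\ xi <> 0].

Definition strong_property_T : Prop :=
  forall alpha : R, 0 < alpha ->
  exists Q (beta : R), [/\ Q != fset0, 0 < beta &
    forall H xi, almost_central H Q beta xi ->
      hnorm (xi - proj_central xi) < alpha].

Definition kazhdan Q H (K : set H) : \bar R :=
  ereal_inf [set (Num.sqrt (\sum_(x <- Q)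
                    hnorm (lact x xi - ract xi x) ^+ 2))%:E
            | xi in [set xi : H | orth_compl K xi /\ hnorm xi = 1]].

Definition kazhdan_sup H (K : set H) : \bar R :=
  ereal_sup [set kazhdan Q K | Q in [set Q : {fset A} | Q != fset0]].

(* H is the Hilbert space direct sum of the bimodules M i, up to unitary
   equivalence: the u i are the canonical embeddings. *)
Definition hilbert_sum (I : Type) (M : I -> bimodule D) H : Prop :=
  exists u : forall i, M i -> H,
  [/\ forall i, linear (u i),
      forall i d v, u i (rep d v) = rep d (u i v),
      forall i v w, inner (u i v) (u i w) = inner v w,
      forall i j v w, i <> j -> inner (u i v) (u j w) = 0
    & forall S : set H, subspace S -> closed S ->
        (forall i v, S (u i v)) -> forall xi, S xi].

End Bimodules.
Arguments central {R A D} H _.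
Arguments almost_central {R A D} H Q beta _.
Arguments central_span {R A D} H _.

Definition is_state (R : realType) (B : cstarType R) (tau : B -> R[i]) : Prop :=
  [/\ scalar tau, forall x, 0 <= tau (star x * x) & tau 1 = 1].

Definition state (R : realType) (B : cstarType R) : Type :=
  {tau : B -> R[i] | is_state tau}.

Definition tracial_state (R : realType) (B : cstarType R) : Type :=
  {tau : B -> R[i] | is_state tau /\ forall x y, tau (x * y) = tau (y * x)}.

Section Universal.
Variables (R : realType) (A : cstarType R) (D : cstar_double A).

(* In both GNS predicates, L x is the class of x in the GNS space of tau. *)
Definition is_gns (M : bimodule D) (tau : D -> R[i]) : Prop :=
  exists L : D -> M,
  [/\ linear L,
      forall x y, inner (L x) (L y) = tau (star y * x),
      dense (range L)
    & forall d x, rep d (L x) = L (d * x)].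

Definition is_tracial_gns (M : bimodule D) (tau : A -> R[i]) : Prop :=
  exists L : A -> M,
  [/\ linear L,
      forall x y, inner (L x) (L y) = tau (star y * x),
      dense (range L)
    & forall a x, lact a (L x) = L (a * x) /\ ract (L x) a = L (x * a)].

Definition universal_bimodule (H : bimodule D) : Prop :=
  exists M : state D -> bimodule D,
    (forall tau, is_gns (M tau) (sval tau)) /\ hilbert_sum M H.

Definition standard_bimodule (K : bimodule D) : Prop :=
  exists M : tracial_state A -> bimodule D,
    (forall tau, is_tracial_gns (M tau) (sval tau)) /\ hilbert_sum M K.

(* The cardinal alpha_tau is that of the type alpha tau, and N tau is the direct
   sum of alpha tau copies of the GNS bimodule M tau. *)
Definition quasi_standard_bimodule (H : bimodule D) : Prop :=
  exists (alpha : tracial_state A -> Type) (M N : tracial_state A -> bimodule D),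
  [/\ forall tau, is_tracial_gns (M tau) (sval tau),
      forall tau, hilbert_sum (fun _ : alpha tau => M tau) (N tau)
    & hilbert_sum N H].

End Universal.

(* Main.v *)
(* For a vector orthogonal to the central vectors, the defect |a.xi - xi.a| and
   the orthogonality itself depend only on the cyclic bimodule generated by xi,
   that is, on the vector state of xi.  Every state of A^Dou occurs in the
   universal bimodule, so a spectral gap there is a spectral gap in all
   bimodules; this gives (a) and (c).  A central vector xi generates the GNS
   bimodule of the trace a |-> <a.xi, xi>, so H_C is exhausted by orthogonal sums
   of pieces of the standard bimodule, and a spectral gap of the latter is one of
   all H_C.  Quasi-standard bimodules satisfy H_C = H, which gives (b), and
   H = H_C + H_C^perp gives (d). *)
Require Import Defs.
From mathcomp Require Import all_boot all_order all_algebra.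
From mathcomp Require Import sesquilinear complex.
From mathcomp Require Import finmap all_classical all_reals ereal.
From mathcomp Require Import topology normedtype ring lra.

Set Implicit Arguments.
Unset Strict Implicit.
Unset Printing Implicit Defensive.

Import Order.TTheory GRing.Theory Num.Theory.
Import numFieldNormedType.Exports.

Local Open Scope classical_set_scope.
Local Open Scope complex_scope.
Local Open Scope ring_scope.

Local Notation Re := complex.Re.
Local Notation subspace := Defs.subspace.
#[local] Arguments complex.Re : simpl never.

(** Positivity of a Kazhdan constant is turned into one quadratic inequality, [gap_on Q t]: it is
    homogeneous, survives closures, and adds up over orthogonal sums of sub-bimodules with the same
    [t]. Two obstacles shape the rest. Equal vector states identify only cyclic sub-bimodules, not
    the bimodules around them, so orthogonality to the central vectors has to be tested inside a
    closed sub-bimodule; this works because the projection onto it commutes with both actions and so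
    preserves central vectors. And the sub-bimodule condition speaks only of [A] acting on the left
    and on the right, whereas the property (T) argument needs invariance under all of A^Dou; density
    of the algebraic tensor product gives this once the operator norm of [rep d] is controlled by
    [cnorm d]. A representation is only assumed to act by continuous operators, so this control is
    derived from positivity, through square roots of [1 - h] for small self-adjoint [h]. *)

Lemma near_invS_lt (R : realType) (e : R) :
  0 < e -> exists N, forall n, (N <= n)%N -> n.+1%:R^-1 < e.
Proof.
move=> e0; exists (Num.bound e^-1) => n Nn.
rewrite invf_plt ?posrE // (le_lt_trans (ltW (archi_boundP _))) ?invr_ge0 ?ltW//.
by rewrite ltr_nat ltnS.
Qed.

(** * Hilbert space geometry: closed subspaces and orthogonal projections *)

Section HilbertSpace.
Variables (R : realType) (H : hilbertType R).
Implicit Types (x y z : H) (S : set H).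

Lemma normr_hnorm x : `|x| = (hnorm x)%:C.
Proof. by rewrite /hnorm RRe_real // normr_real. Qed.

Lemma hnorm_ge0 x : 0 <= hnorm x.
Proof. by rewrite -ler0c -normr_hnorm. Qed.

Lemma hnorm0 : hnorm (0 : H) = 0.
Proof. by rewrite /hnorm normr0. Qed.

Lemma hnorm_eq0 x : hnorm x = 0 -> x = 0.
Proof. by move=> x0; apply/normr0_eq0; rewrite normr_hnorm x0. Qed.

Lemma hnorm_gt0 x : x != 0 -> 0 < hnorm x.
Proof.
move=> x0; rewrite lt_neqAle hnorm_ge0 andbT; apply: contra_neq x0 => x0.
exact: hnorm_eq0.
Qed.

Lemma hnormN x : hnorm (- x) = hnorm x.
Proof. by rewrite /hnorm normrN. Qed.

Lemma hdistC x y : hnorm (x - y) = hnorm (y - x).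
Proof. by rewrite /hnorm distrC. Qed.

Lemma le_hnormD x y : hnorm (x + y) <= hnorm x + hnorm y.
Proof. by rewrite -lecR rmorphD /= -!normr_hnorm ler_normD. Qed.

Lemma le_hdist x y z : hnorm (x - z) <= hnorm (x - y) + hnorm (y - z).
Proof. by rewrite -(subrKA y x) le_hnormD. Qed.

Lemma hnormZ (a : R[i]) x : hnorm (a *: x) = Re `|a| * hnorm x.
Proof.
apply: complexI; rewrite rmorphM /= -!normr_hnorm normrZ.
by rewrite RRe_real ?normr_real.
Qed.

Lemma Re_normr_ge0 (a : R[i]) : 0 <= Re `|a|.
Proof. by rewrite -ler0c RRe_real ?normr_real. Qed.

Lemma Re_normr_real (t : R) : Re `|t%:C| = `|t|.
Proof. by rewrite normc_def /= expr0n /= addr0 sqrtr_sqr. Qed.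

Lemma hnormZr (t : R) x : hnorm (t%:C *: x) = `|t| * hnorm x.
Proof. by rewrite hnormZ Re_normr_real. Qed.

Lemma innerxx x : inner x x = (hnorm x ^+ 2)%:C.
Proof. by rewrite -norm_inner normr_hnorm rmorphXn. Qed.

Lemma innerC x y : inner x y = (inner y x)^*.
Proof. by rewrite hermC /= expr0 mul1r. Qed.

Lemma inner_eq0C x y : inner x y = 0 -> inner y x = 0.
Proof. by move=> xy; rewrite innerC xy rmorph0. Qed.

Lemma hnormD2 x y :
  hnorm (x + y) ^+ 2 = hnorm x ^+ 2 + hnorm y ^+ 2 + 2 * Re (inner x y).
Proof.
apply: complexI; rewrite -innerxx dnormD !innerxx.
have -> c : c + Num.conj c = (2 * Re c)%:C :> R[i].
  by rewrite [LHS]addcJ [RHS]rmorphM [X in _ = X * _]rmorph_nat.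
by rewrite -!rmorphD.
Qed.

Lemma hnormB2 x y :
  hnorm (x - y) ^+ 2 = hnorm x ^+ 2 + hnorm y ^+ 2 - 2 * Re (inner x y).
Proof. by rewrite hnormD2 linearNr hnormN raddfN /= mulrN. Qed.

Lemma pythagoras x y : inner x y = 0 ->
  hnorm (x + y) ^+ 2 = hnorm x ^+ 2 + hnorm y ^+ 2.
Proof. by move=> xy; rewrite hnormD2 xy mulr0 addr0. Qed.

Lemma parallelogram x y :
  hnorm (x + y) ^+ 2 + hnorm (x - y) ^+ 2 =
  2 * (hnorm x ^+ 2 + hnorm y ^+ 2).
Proof. by rewrite hnormD2 hnormB2; ring. Qed.

Lemma closureP S x : closure S x <->
  forall e : R, 0 < e -> exists2 y, S y & hnorm (x - y) < e.
Proof.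
split=> [Sx e e0|Sx B /nbhs_ballP[e /= e0 eB]].
  have [|y [Sy xy]] := Sx (ball x e%:C).
    by apply/nbhs_ballP; exists e%:C; rewrite //= ltcR.
  exists y => //; move: xy; rewrite -ball_normE /= normr_hnorm.
  by rewrite ltcR.
have eE : e = (Re e)%:C by rewrite RRe_real // gtr0_real.
have [|y Sy xy] := Sx (Re e); first by rewrite -ltcR -eE.
exists y; split=> //; apply: eB.
by rewrite -ball_normE /= normr_hnorm eE ltcR.
Qed.

Lemma closedP S : closed S <-> closure S `<=` S.
Proof.
split=> [/closure_id <- //|SS]; apply/closure_id/seteqP; split=> //.
exact: subset_closure.
Qed.

Lemma hilbert_complete (u : nat -> H) :
    (forall e : R, 0 < e -> exists N, forall m n,
       (N <= m)%N -> (N <= n)%N -> hnorm (u m - u n) < e) ->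
  exists l, forall e : R, 0 < e ->
    exists N, forall n, (N <= n)%N -> hnorm (u n - l) < e.
Proof.
move=> u_cauchy.
have : cauchy (u n @[n --> \oo]).
  apply: cauchy_exP => e e0.
  have eE : e = (Re e)%:C by rewrite RRe_real // gtr0_real.
  have [|N uN] := u_cauchy (Re e); first by rewrite -ltcR -eE.
  exists (u N), N => // n /= Nn.
  by rewrite -ball_normE /= normr_hnorm eE ltcR uN.
move=> /cauchy_cvgP /cvg_ex[l /cvgrPdist_lt ul]; exists l => e e0.
have [|N _ uN] := ul e%:C; first by rewrite ltcR.
exists N => n Nn; have := uN n Nn.
by rewrite normr_hnorm ltcR hdistC.
Qed.

(** With [c = inner x y], moving [x] by [s c y] for real [s] makes the cross term real: the squared
    norm changes by [s^2 n - 2 s m], which is negative for small positive [s] unless [m = |c|^2]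
    vanishes. *)
Lemma min_dist_orth S x : subspace S ->
  (forall y, S y -> hnorm x <= hnorm (x - y)) -> orth_compl S x.
Proof.
move=> [S0 SD] min_x y Sy; set c := inner x y.
set m := Re `|c| ^+ 2; set n := hnorm (c *: y) ^+ 2.
have n0 : 0 <= n by rewrite sqr_ge0.
have m0 : 0 <= m by rewrite sqr_ge0.
have n1 : 0 < n + 1 by rewrite ltr_wpDl.
(* Close to the minimizer m / n of s |-> |x - s c y|^2, and defined when n = 0. *)
pose s := m / (n + 1).
have sn : s * (n + 1) = m by rewrite /s mulfVK // gt_eqF.
have s0 : 0 <= s by rewrite divr_ge0 // ltW.
have := min_x ((s%:C * c) *: y).
rewrite -scalerA -{1}[s%:C *: _]addr0 => /(_ (SD _ _ _ _ S0)).
rewrite -[X in S X]addr0 => /(_ (SD _ _ _ Sy S0)).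
rewrite -(@ler_pXn2r _ 2) ?nnegrE ?hnorm_ge0 // hnormB2 hnormZr exprMn.
rewrite -/n ger0_norm // linearZr /= linearZr /=.
have -> : Num.conj s%:C * (Num.conj c * inner x y) = (s * m)%:C.
  rewrite -normCKC [Num.conj _]conjc_real [RHS]rmorphM rmorphXn.
  by rewrite -[in LHS](RRe_real (normr_real c)).
rewrite -[Re (s * m)%:C]/(s * m) => le_s.

have s2 : 2 * s * m <= s ^+ 2 * n by rewrite -subr_ge0; move: le_s; lra.
have sm : s = 0 \/ 2 * m <= s * n.
  case: (ltgtP s 0) s0 => // [s_gt0 _|-> _]; [right|by left].
  by rewrite -(ler_pM2l s_gt0); move: s2; lra.
(* In the second case [s * n = m - s <= m], so [2 * m <= m]. *)
have m00 : m = 0.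
  by case: sm => [s00|]; [move: sn; rewrite s00 mul0r|move: sn; nra].
have {}m00 : Re `|c| = 0 by apply/eqP; rewrite -sqrf_eq0; apply/eqP.
by apply/normr0_eq0; rewrite -(RRe_real (normr_real c)) m00.
Qed.

Lemma subspaceD S x y : subspace S -> S x -> S y -> S (x + y).
Proof. by move=> [_ SD] Sx Sy; rewrite -[x]scale1r; apply: SD. Qed.

Lemma subspaceZ S (a : R[i]) x : subspace S -> S x -> S (a *: x).
Proof. by move=> [S0 SD] Sx; rewrite -[_ *: _]addr0; apply: SD. Qed.

Lemma subspaceB S x y : subspace S -> S x -> S y -> S (x - y).
Proof.
by move=> SS Sx Sy; rewrite -scaleN1r; apply: subspaceD => //; apply: subspaceZ.
Qed.

Lemma subspace_sum S I (r : seq I) (F : I -> H) : subspace S ->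
  (forall i, S (F i)) -> S (\sum_(i <- r) F i).
Proof.
move=> SS SF; elim/big_rec: _ => [|i y _ Sy]; first by case: SS.
exact: subspaceD.
Qed.

Lemma subspaceI S S' : subspace S -> subspace S' -> subspace (S `&` S').
Proof.
move=> [S0 SD] [S'0 S'D]; split=> // a x y [Sx S'x] [Sy S'y].
by split; [apply: SD | apply: S'D].
Qed.

Lemma subspace_closure S : subspace S -> subspace (closure S).
Proof.
move=> [S0 SD]; split=> [|a x y Sx Sy]; first exact: subset_closure.
apply/closureP => e e0.
have a1 : 0 < Re `|a| + 1 by rewrite ltr_wpDl // Re_normr_ge0.
have [|x' Sx' xx'] := (closureP S x).1 Sx (e / 2 / (Re `|a| + 1)).
  by rewrite !divr_gt0.
have [|y' Sy' yy'] := (closureP S y).1 Sy (e / 2); first by rewrite divr_gt0.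
exists (a *: x' + y'); first exact: SD.
rewrite opprD addrACA -scalerBr (le_lt_trans (le_hnormD _ _)) // hnormZ.
rewrite (splitr e) ler_ltD //; move: xx'; rewrite ltr_pdivlMr //.
have := hnorm_ge0 (x - x'); lra.
Qed.

(** Orthogonality is phrased by norms alone, a form that passes to limits and through isometric
    relations. *)
Lemma orth_complP S x : subspace S ->
  orth_compl S x <-> forall y, S y -> hnorm x <= hnorm (x - y).
Proof.
move=> SS; split=> [xS y Sy|]; last exact: min_dist_orth.
rewrite -(@ler_pXn2r _ 2) ?nnegrE ?hnorm_ge0 // pythagoras.
  by rewrite lerDl sqr_ge0.
by rewrite raddfN /= xS // oppr0.
Qed.

Lemma orth_compl_subspace S : subspace (orth_compl S).
Proof.
split=> [y _|a x y xS yS z Sz]; first by rewrite linear0l.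
by rewrite linearDl linearZl_LR /= xS // yS // mulr0 addr0.
Qed.

Lemma orth_compl_closed S : subspace S -> closed (orth_compl S).
Proof.
move=> SS; apply/closedP => x xS; apply/orth_complP => // y Sy.
apply/ler_addgt0Pr => e e0.
have [|x' x'S xx'] := (closureP _ x).1 xS (e / 2); first by rewrite divr_gt0.
have := (orth_complP x' SS).1 x'S y Sy.
have := le_hdist x x' 0; have := le_hdist x' x y; rewrite !subr0 (hdistC x' x).
move: xx'; lra.
Qed.

Lemma bounded_closed_ker (f : H -> H) : (forall x y, f (x - y) = f x - f y) ->
  (exists2 C : R, 0 < C & forall x, hnorm (f x) <= C * hnorm x) ->
  closed [set x | f x = 0].
Proof.
move=> fB [C C0 fC]; apply/closedP => x /closureP xf.
apply/hnorm_eq0/eqP; rewrite eq_le hnorm_ge0 andbT.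
apply/ler_addgt0Pr => e e0; rewrite add0r.
have [|y /= fy xy] := xf (e / C); first by rewrite divr_gt0.
have := fC (x - y); rewrite fB fy subr0 => /le_trans; apply.
by rewrite mulrC -ler_pdivlMr // ltW.
Qed.

Lemma closed_set0 : closed [set 0 : H].
Proof.
by apply: (@bounded_closed_ker id) => //; exists 1 => // x; rewrite mul1r.
Qed.

(** A sequence in [S] minimizing the distance to [x] is Cauchy by the parallelogram law, and its
    limit is a nearest point. *)
Lemma exists_orth_proj S x : subspace S -> closed S ->
  exists p, S p /\ orth_compl S (x - p).
Proof.
move=> SS /closedP Scl.
pose E := [set hnorm (x - y) ^+ 2 | y in S].
have E_inf : has_inf E.
  split; first by exists (hnorm (x - 0) ^+ 2), 0 => //; case: SS.
  by exists 0 => _ [y _ <-]; rewrite sqr_ge0.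
pose d := inf E.
have d_le y : S y -> d <= hnorm (x - y) ^+ 2.
  by move=> Sy; apply: ge_inf; [case: E_inf | exists y].
have /choice[u uP] (n : nat) :
    exists y, S y /\ hnorm (x - y) ^+ 2 < d + n.+1%:R^-1.
  have [|_ [y Sy <-] yd] := inf_adherent (_ : 0 < n.+1%:R^-1 :> R) E_inf.
    by rewrite invr_gt0.
  by exists y.
have uS n : S (u n) by case: (uP n).
have ud n : hnorm (x - u n) ^+ 2 < d + n.+1%:R^-1 by case: (uP n).
have [|l ul] := hilbert_complete (u := u).
  (* The midpoint of [u n] and [u m] is in [S], so the squared distance of the two is at most
     [2 (1/(n+1) + 1/(m+1))], below [e^2] by this choice. *)
  move=> e e0; have [|N smallN] := @near_invS_lt R (e ^+ 2 / 4).
    by rewrite divr_gt0 ?exprn_gt0.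
  exists N => m n Nm Nn; rewrite -(@ltr_pXn2r _ 2) ?nnegrE ?hnorm_ge0 1?ltW //.
  have := parallelogram (x - u n) (x - u m).
  have -> : x - u n - (x - u m) = u m - u n by rewrite opprB addrC subrKA.
  have -> : x - u n + (x - u m) =
      (2 : R)%:C *: (x - (2^-1 : R)%:C *: (u n + u m)).
    rewrite scalerBr scalerA -(rmorphM (real_complex R)) divff ?pnatr_eq0 //.
    by rewrite scale1r rmorph_nat scaler_nat mulr2n addrACA opprD.
  rewrite hnormZr exprMn ger0_norm //.
  have := d_le ((2^-1 : R)%:C *: (u n + u m)).
  move=> /(_ (subspaceZ _ SS (subspaceD SS (uS n) (uS m)))).
  have := smallN m Nm; have := smallN n Nn; have := ud n; have := ud m.
  by move: (n.+1%:R^-1) (m.+1%:R^-1) => ? ?; lra.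
have Sl : S l.
  apply/Scl/closureP => e /ul[N uN]; exists (u N) => //.
  by rewrite hdistC uN.
exists l; split=> //; apply: min_dist_orth => // y Sy.
(* If a point of [S] were at distance [b < a = |x - l|], then for large [n] the vector [u n] would
   be within [(a + b) / 2] of [x] and [(a - b) / 2] of [l], giving [a < a]. *)
rewrite -addrA -opprD leNgt; apply/negP.
have := subspaceD SS Sl Sy; move: (l + y) => {Sy}y Sy yl.
set a := hnorm (x - l) in yl; set b := hnorm (x - y) in yl.
have b0 : 0 <= b by exact: hnorm_ge0.
have [|N uN] := ul ((a - b) / 2); first by rewrite divr_gt0 // subr_gt0.
have [|N' smallN] := @near_invS_lt R (((a + b) / 2) ^+ 2 - b ^+ 2).
  by rewrite subr_gt0 ltr_pXn2r ?nnegrE //; move: yl b0; lra.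
have [n Nn N'n] : exists2 n, (N <= n)%N & (N' <= n)%N.
  by exists (maxn N N'); rewrite ?leq_maxl ?leq_maxr.
have := uN n Nn; have := smallN n N'n.
have := ud n; have := d_le y Sy; have := le_hdist x (u n) l; rewrite -/a -/b.
move=> h1 h2 h3 h4 h5.
have : hnorm (x - u n) < (a + b) / 2.
  rewrite -(@ltr_pXn2r _ 2) ?nnegrE ?hnorm_ge0 //; last by move: yl b0; lra.
  by move: h2 h3 h4; move: (n.+1%:R^-1) => ?; lra.
move: h1 h5; lra.
Qed.

Lemma orth_projP S x : subspace S -> closed S ->
  S (orth_proj S x) /\ orth_compl S (x - orth_proj S x).
Proof.
move=> SS Scl; rewrite /orth_proj; case: xgetP => [p _ //|].
by have [p Sp] := exists_orth_proj x SS Scl => /(_ p).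
Qed.

Lemma orth_proj_uniq S x p : subspace S -> closed S ->
  S p -> orth_compl S (x - p) -> orth_proj S x = p.
Proof.
move=> SS Scl Sp xp; have [Sq xq] := orth_projP x SS Scl.
apply/subr0_eq/hnorm_eq0/eqP; rewrite -sqrf_eq0; apply/eqP/complexI.
rewrite -innerxx; have := subspaceB SS Sq Sp; set q := _ - p => Sq'.
rewrite [q in inner q _](_ : _ = x - p - (x - orth_proj S x)).
  by rewrite linearBl /= xp // xq // subr0.
by rewrite opprB [RHS]addrC subrKA.
Qed.

Lemma hnorm_orth_proj S x : subspace S -> closed S ->
  hnorm x ^+ 2 = hnorm (orth_proj S x) ^+ 2 + hnorm (x - orth_proj S x) ^+ 2.
Proof.
move=> SS Scl; have [Sq xq] := orth_projP x SS Scl.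
rewrite -pythagoras; first by rewrite addrC subrK.
exact/inner_eq0C/xq.
Qed.

Lemma le_hnorm_orth_compl S x : subspace S -> closed S ->
  hnorm (x - orth_proj S x) <= hnorm x.
Proof.
move=> SS Scl; rewrite -(@ler_pXn2r _ 2) ?nnegrE ?hnorm_ge0 //.
by rewrite [leRHS](hnorm_orth_proj _ SS Scl) lerDr sqr_ge0.
Qed.

Lemma orth_proj_linear S : subspace S -> closed S -> linear (orth_proj S).
Proof.
move=> SS Scl a x y; have [Sx xS] := orth_projP x SS Scl.
have [Sy yS] := orth_projP y SS Scl.
apply: orth_proj_uniq => //; first exact: SS.2.
rewrite opprD addrACA -scalerBr.
exact: (orth_compl_subspace S).2.
Qed.

Lemma orth_projB S x y : subspace S -> closed S ->
  orth_proj S (x - y) = orth_proj S x - orth_proj S y.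
Proof.
by move=> SS Scl; rewrite addrC -scaleN1r orth_proj_linear // scaleN1r addrC.
Qed.

End HilbertSpace.

(** * Commutators with elements of [A], central vectors and their span *)

Section Bimodule.
Variables (R : realType) (A : cstarType R) (D : cstar_double A).
Variable H : bimodule D.
Implicit Types (x y z : H) (S : set H) (a b : A) (d : D) (Q : {fset A}).

Lemma repB d x y : rep d (x - y) = rep d x - rep d y.
Proof. by rewrite -scaleN1r addrC rep_linear scaleN1r addrC. Qed.

Lemma rep0 d : rep d (0 : H) = 0.
Proof. by rewrite -(subrr (0 : H)) repB !subrr. Qed.

Lemma repZ d (c : R[i]) x : rep d (c *: x) = c *: rep d x.
Proof. by rewrite -[c *: x]addr0 rep_linear rep0 addr0. Qed.

(** Continuity at 0 gives a ball of radius [e] sent into the unit ball; rescaling [x] to norm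
    [e / 2] yields the constant [2 / e]. It depends on [d] in an uncontrolled way. *)
Lemma rep_bounded d :
  exists2 C : R, 0 < C & forall x, hnorm (rep d x) <= C * hnorm x.
Proof.
have /cvgrPdist_lt/(_ 1 ltr01) := @rep_continuous _ _ _ H d 0.
move=> /nbhs_ballP[e /= e0 eB].
have eE : e = (Re e)%:C by rewrite RRe_real // gtr0_real.
have e0' : 0 < Re e by rewrite -ltcR -eE.
exists (2 / Re e); first by rewrite divr_gt0.
move=> x; have [->|x0] := eqVneq x 0; first by rewrite rep0 hnorm0 mulr0.
have hx0 := hnorm_gt0 x0.
pose s := Re e / (2 * hnorm x).
have s0 : 0 < s by rewrite divr_gt0 // mulr_gt0.
have sx : s * hnorm x = Re e / 2 by rewrite /s invfM mulrA mulfVK ?gt_eqF.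
have := eB (s%:C *: x); rewrite -ball_normE /= sub0r normrN normr_hnorm.
rewrite {1}eE ltcR hnormZr gtr0_norm // sx => /(_ _)/wrap[].
  by rewrite ltr_pdivrMr // ltr_pMr // ltr1n.
rewrite rep0 sub0r normrN repZ normr_hnorm.
rewrite hnormZr gtr0_norm // ltcR => /ltW le1.
rewrite -(ler_pM2l s0) (le_trans le1) // mulrCA sx mulrA mulfVK ?gt_eqF //.
by rewrite divff ?pnatr_eq0.
Qed.

Lemma star_dou_l a : star (dou_l D a) = dou_l D (star a).
Proof. by case: (dou_max_tensor D) => -[/(_ a) <-]. Qed.

Lemma star_dou_r b : star (dou_r D b) = dou_r D (star b : A).
Proof. by case: (dou_max_tensor D) => -[_ /(_ b) <-]. Qed.

Lemma dou_comm a b : dou_l D a * dou_r D b = dou_r D b * dou_l D a.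
Proof. by case: (dou_max_tensor D). Qed.

Lemma inner_lact a x y : inner (lact a x) y = inner x (lact (star a) y).
Proof. by rewrite /lact rep_star star_dou_l. Qed.

Lemma inner_ract b x y : inner (ract x b) y = inner x (ract y (star b)).
Proof. by rewrite /ract rep_star star_dou_r. Qed.

Lemma lactM a b x : lact (a * b) x = lact a (lact b x).
Proof. by rewrite /lact rmorphM repM. Qed.

Lemma lact_ract a b x : lact a (ract x b) = ract (lact a x) b.
Proof. by rewrite /lact /ract -!repM dou_comm. Qed.

Lemma lact1 x : lact 1 x = x.
Proof. by rewrite /lact rmorph1 rep1. Qed.

Definition defect a x : H := lact a x - ract x a.

(** The commutator is the action of a single element of A^Dou, so it inherits linearity, boundedness
    and continuity from [rep]. *)
Lemma defectE a x : defect a x = rep (dou_l D a - dou_r D a) x.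
Proof.
rewrite -[dou_l D a - _]addrC -scaleN1r rep_linearl scaleN1r.
by rewrite /defect /lact /ract addrC.
Qed.

Lemma defectB a x y : defect a (x - y) = defect a x - defect a y.
Proof. by rewrite !defectE repB. Qed.

Lemma defect_linear a : linear (defect a).
Proof. by move=> c x y; rewrite !defectE rep_linear. Qed.

Lemma defect_bounded a :
  exists2 C : R, 0 < C & forall x, hnorm (defect a x) <= C * hnorm x.
Proof.
have [C C0 dC] := rep_bounded (dou_l D a - dou_r D a).
by exists C => // x; rewrite defectE.
Qed.

Lemma centralP x : central H x <-> forall a, defect a x = 0.
Proof.
split=> [xc a|xd a]; first by rewrite /defect xc subrr.
exact/subr0_eq/xd.
Qed.

Lemma central_subspace : subspace (central H).
Proof.
split=> [|c x y /centralP xc /centralP yc]; apply/centralP => a.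
  by rewrite -(subrr (0 : H)) defectB !subrr.
by rewrite defect_linear xc yc scaler0 addr0.
Qed.

Lemma central_closed : closed (central H).
Proof.
rewrite (_ : central H = \bigcap_(a in setT) [set x | defect a x = 0]).
  apply: closed_bigI => a _; apply: bounded_closed_ker; first exact: defectB.
  exact: defect_bounded.
by apply/seteqP; split=> [x /centralP xc a _|x xc]; [|apply/centralP => a];
  apply: xc.
Qed.

Lemma subbimodule_orth_compl S : subbimodule S -> subbimodule (orth_compl S).
Proof.
move=> [SS Sact]; split=> [|a x xS]; first exact: orth_compl_subspace.
split=> y Sy; first by rewrite inner_lact xS //; apply: (Sact _ _ Sy).1.
by rewrite inner_ract xS //; apply: (Sact _ _ Sy).2.
Qed.

Lemma closure_rep S d : (forall x, S x -> S (rep d x)) ->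
  forall x, closure S x -> closure S (rep d x).
Proof.
move=> Sd x /closureP Sx; apply/closureP => e e0.
have [C C0 dC] := rep_bounded d.
have [|y Sy xy] := Sx (e / C); first by rewrite divr_gt0.
exists (rep d y); first exact: Sd.
by rewrite -repB (le_lt_trans (dC _)) // mulrC -ltr_pdivlMr.
Qed.

Lemma subbimodule_closure S : subbimodule S -> subbimodule (closure S).
Proof.
move=> [SS Sact]; split=> [|a x Sx]; first exact: subspace_closure.
by split; apply: closure_rep Sx => y Sy; case: (Sact a y Sy).
Qed.

Lemma central_span_subbimodule : subbimodule (central_span H).
Proof.
split=> [|a x Hx]; last first.
  by split=> S SS Scl HS; apply: (SS.2 _ _ _).1 || apply: (SS.2 _ _ _).2;
    apply: Hx.
split=> [S [[S0 _] _] //|c x y Hx Hy S SS Scl HS].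
by apply: SS.1.2; [apply: Hx|apply: Hy].
Qed.

Lemma central_span_closed : closed (central_span H).
Proof.
apply/closedP => x /closureP Hx S SS Scl HS; apply: (closedP S).1 => //.
by apply/closureP => e /Hx[y Hy xy]; exists y => //; apply: Hy.
Qed.

Lemma central_sub_span : central H `<=` central_span H.
Proof. by move=> x xc S _ _; apply. Qed.

Lemma orth_proj_lact S a x : subbimodule S -> closed S ->
  orth_proj S (lact a x) = lact a (orth_proj S x).
Proof.
move=> SS Scl; have [Sp xp] := orth_projP x SS.1 Scl.
apply: orth_proj_uniq => //; first exact: SS.1.
  by apply: (SS.2 _ _ _).1.
rewrite -repB; exact: ((subbimodule_orth_compl SS).2 _ _ xp).1.
Qed.

Lemma orth_proj_ract S a x : subbimodule S -> closed S ->
  orth_proj S (ract x a) = ract (orth_proj S x) a.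
Proof.
move=> SS Scl; have [Sp xp] := orth_projP x SS.1 Scl.
apply: orth_proj_uniq => //; first exact: SS.1.
  by apply: (SS.2 _ _ _).2.
rewrite -repB; exact: ((subbimodule_orth_compl SS).2 _ _ xp).2.
Qed.

Lemma orth_proj_central S x : subbimodule S -> closed S ->
  central H x -> central H (orth_proj S x).
Proof.
by move=> SS Scl xc a; rewrite -orth_proj_lact // xc orth_proj_ract.
Qed.

(** A central [z] splits into its projection to [S], which is again central, and a part orthogonal
    to [S], hence to [x]. So the test is intrinsic to any closed sub-bimodule containing [x]. *)
Lemma orth_central_in S x : subbimodule S -> closed S -> S x ->
  orth_compl (central H `&` S) x -> orth_compl (central H) x.
Proof.
move=> SS Scl Sx xc z zc; have [Sp zp] := orth_projP z SS.1 Scl.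
rewrite -(subrK (orth_proj S z) z) raddfD /= (xc (orth_proj S z)); last first.
  by split=> //; apply: orth_proj_central.
by rewrite addr0; apply/inner_eq0C/zp.
Qed.

(** The complement of [S] is a closed sub-bimodule containing the central vectors, so it contains
    all that they generate. *)
Lemma orth_compl_central_span S : subbimodule S ->
  S `<=` orth_compl (central H) -> S `<=` orth_compl (central_span H).
Proof.
move=> SS Sc x Sx y; move/(_ (orth_compl S)) => yS; apply: inner_eq0C.
apply: (yS _ _ _ x Sx); first exact: subbimodule_orth_compl.
  exact: orth_compl_closed SS.1.
by move=> z zc w Sw; apply/inner_eq0C/Sc.
Qed.

End Bimodule.

(** * Unitary equivalences between closed sub-bimodules, as relations *)

Section Intertwiner.
Variables (R : realType) (A : cstarType R) (D : cstar_double A).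
Implicit Types (H : bimodule D) (a b : A) (d : D).

(* A closed intertwiner is the graph of a unitary bimodule map between closed
   sub-bimodules of H1 and H2; exchanging the arguments inverts it. *)
Definition intertwiner H1 H2 (G : H1 -> H2 -> Prop) : Prop :=
  [/\ G 0 0,
      forall (c : R[i]) x x' y y',
        G x y -> G x' y' -> G (c *: x + x') (c *: y + y'),
      forall x y, G x y -> hnorm x = hnorm y,
      forall a x y, G x y -> G (lact a x) (lact a y)
    & forall a x y, G x y -> G (ract x a) (ract y a)].

Definition rel_closure H1 H2 (G : H1 -> H2 -> Prop) (x : H1) (y : H2) : Prop :=
  forall e : R, 0 < e ->
  exists x' y', [/\ G x' y', hnorm (x - x') < e & hnorm (y - y') < e].

Definition rel_closed H1 H2 (G : H1 -> H2 -> Prop) : Prop :=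
  forall x y, rel_closure G x y -> G x y.

Lemma sub_rel_closure H1 H2 (G : H1 -> H2 -> Prop) x y :
  G x y -> rel_closure G x y.
Proof. by move=> Gxy e e0; exists x, y; rewrite !subrr !hnorm0. Qed.

Lemma rel_closure_closed H1 H2 (G : H1 -> H2 -> Prop) :
  rel_closed (rel_closure G).
Proof.
move=> x y Gxy e e0; have e2 : 0 < e / 2 by rewrite divr_gt0.
have [x' [y' [Gxy' xx' yy']]] := Gxy _ e2.
have [x2 [y2 [Gxy2 xx2 yy2]]] := Gxy' _ e2.
exists x2, y2; split=> //; rewrite (splitr e).
  by rewrite (le_lt_trans (le_hdist _ x' _)) // ltrD.
by rewrite (le_lt_trans (le_hdist _ y' _)) // ltrD.
Qed.

Lemma rel_closure_rep H1 H2 (G : H1 -> H2 -> Prop) d :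
    (forall x y, G x y -> G (rep d x) (rep d y)) ->
  forall x y, rel_closure G x y -> rel_closure G (rep d x) (rep d y).
Proof.
move=> Gd x y Gxy e e0.
have [C1 C10 dC1] := rep_bounded H1 d; have [C2 C20 dC2] := rep_bounded H2 d.
have C0 : 0 < C1 + C2 by rewrite addr_gt0.
have [|x' [y' [Gxy' xx' yy']]] := Gxy (e / (C1 + C2)); first by rewrite divr_gt0.
exists (rep d x'), (rep d y'); split; first exact: Gd.
  rewrite -repB (le_lt_trans (dC1 _)) // mulrC -ltr_pdivlMr //.
  by rewrite (lt_le_trans xx') // ler_pM2l // lef_pV2 ?posrE // lerDl ltW.
rewrite -repB (le_lt_trans (dC2 _)) // mulrC -ltr_pdivlMr //.
by rewrite (lt_le_trans yy') // ler_pM2l // lef_pV2 ?posrE // lerDr ltW.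
Qed.

Lemma intertwiner_closure H1 H2 (G : H1 -> H2 -> Prop) :
  intertwiner G -> intertwiner (rel_closure G).
Proof.
move=> [G0 GD Gn Gl Gr]; split=> [|c x x' y y' Gxy Gxy' e e0|x y Gxy|a|a].
- exact: sub_rel_closure.
- have c1 : 0 < Re `|c| + 1 by rewrite ltr_wpDl // Re_normr_ge0.
  have [|x1 [y1 [G1 xx1 yy1]]] := Gxy (e / 2 / (Re `|c| + 1)).
    by rewrite !divr_gt0.
  have [|x2 [y2 [G2 xx2 yy2]]] := Gxy' (e / 2); first by rewrite divr_gt0.
  have bound (H : bimodule D) (u u1 v v1 : H) :
      hnorm (u - u1) < e / 2 / (Re `|c| + 1) -> hnorm (v - v1) < e / 2 ->
      hnorm (c *: u + v - (c *: u1 + v1)) < e.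
    move=> uu1 vv1; rewrite opprD addrACA -scalerBr.
    rewrite (le_lt_trans (le_hnormD _ _)) // hnormZ.
    rewrite (splitr e) ler_ltD //; move: uu1; rewrite ltr_pdivlMr //.
    have := hnorm_ge0 (u - u1); lra.
  exists (c *: x1 + x2), (c *: y1 + y2).
  by split; [apply: GD | apply: bound | apply: bound].
- apply/eqP; rewrite eq_le; apply/andP; split; apply/ler_addgt0Pr => e e0;
  have [|x' [y' [/Gn Gxy' xx' yy']]] := Gxy (e / 2); rewrite ?divr_gt0 //.
  + have := le_hdist x x' 0; have := le_hdist y' y 0; rewrite !subr0 (hdistC y').
    move: xx' yy'; lra.
  + have := le_hdist y y' 0; have := le_hdist x' x 0; rewrite !subr0 (hdistC x').
    move: xx' yy'; lra.
- exact/rel_closure_rep/Gl.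
- exact/rel_closure_rep/Gr.
Qed.

Lemma intertwiner_sym H1 H2 (G : H1 -> H2 -> Prop) :
  intertwiner G -> intertwiner (fun y x => G x y).
Proof.
move=> [G0 GD Gn Gl Gr]; split=> //.
- by move=> c x x' y y'; apply: GD.
- by move=> x y /Gn.
- by move=> a x y; apply: Gl.
- by move=> a x y; apply: Gr.
Qed.

Lemma rel_closed_sym H1 H2 (G : H1 -> H2 -> Prop) :
  rel_closed G -> rel_closed (fun y x => G x y).
Proof.
move=> Gcl y x Gyx; apply: Gcl => e /Gyx[y' [x' [Gxy yy' xx']]].
by exists x', y'.
Qed.

(** The graph is the closure of the pairs [(L1 u, L2 u)]; equality of norms makes it single-valued
    in both directions. The parameter space [X] will be A^Dou for a state and [A] for a trace. *)
Lemma intertwiner_of_maps (X : lmodType R[i]) H1 H2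
    (L1 : X -> H1) (L2 : X -> H2) (la ra : A -> X -> X) :
    linear L1 -> linear L2 -> (forall u, hnorm (L1 u) = hnorm (L2 u)) ->
    (forall a u, L1 (la a u) = lact a (L1 u) /\ L2 (la a u) = lact a (L2 u)) ->
    (forall a u, L1 (ra a u) = ract (L1 u) a /\ L2 (ra a u) = ract (L2 u) a) ->
  exists G : H1 -> H2 -> Prop,
    [/\ intertwiner G, rel_closed G & forall u, G (L1 u) (L2 u)].
Proof.
move=> L1D L2D L12 Lla Lra.
pose G x y := exists u, x = L1 u /\ y = L2 u.
exists (rel_closure G); split; last first.
- by move=> u; apply: sub_rel_closure; exists u.
- exact: rel_closure_closed.
apply: intertwiner_closure; split.
- exists 0; have := L1D (-1) 0 0; have := L2D (-1) 0 0.
  by rewrite !scaler0 !addr0 !scaleN1r !addNr.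
- move=> c _ _ _ _ [u [-> ->]] [v [-> ->]]; exists (c *: u + v).
  by rewrite L1D L2D.
- by move=> _ _ [u [-> ->]].
- by move=> a _ _ [u [-> ->]]; exists (la a u); have [-> ->] := Lla a u.
- by move=> a _ _ [u [-> ->]]; exists (ra a u); have [-> ->] := Lra a u.
Qed.

Section ClosedIntertwiner.
Variables (H1 H2 : bimodule D) (G : H1 -> H2 -> Prop).
Hypotheses (GI : intertwiner G) (Gcl : rel_closed G).

Lemma intertwinerB x x' y y' : G x y -> G x' y' -> G (x - x') (y - y').
Proof.
move=> Gxy Gxy'; rewrite [x - _]addrC [y - _]addrC -(scaleN1r x') -(scaleN1r y').
by case: GI => _ GD _ _ _; apply: GD.
Qed.

Lemma intertwiner_hnorm x y : G x y -> hnorm x = hnorm y.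
Proof. by case: GI => _ _ Gn _ _; apply: Gn. Qed.

Lemma intertwiner_defect a x y : G x y -> hnorm (defect a x) = hnorm (defect a y).
Proof.
move=> Gxy; case: (GI) => _ _ _ Gl Gr.
exact: intertwiner_hnorm (intertwinerB (Gl _ _ _ Gxy) (Gr _ _ _ Gxy)).
Qed.

Definition intertwiner_dom : set H1 := [set x | exists y, G x y].

Lemma intertwiner_dom_subbimodule : subbimodule intertwiner_dom.
Proof.
case: GI => G0 GD Gn Gl Gr; split; last first.
  move=> a x [y Gxy]; split; first by exists (lact a y); apply: Gl.
  by exists (ract y a); apply: Gr.
split=> [|c x x' [y Gxy] [y' Gxy']]; first by exists 0.
by exists (c *: y + y'); apply: GD.
Qed.

(** Partners of a convergent sequence form a Cauchy sequence, since [G] is isometric; its limit is a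
    partner of the limit because [G] is closed. *)
Lemma intertwiner_dom_closed : closed intertwiner_dom.
Proof.
apply/closedP => x /closureP xG.
have /choice[u uP] (n : nat) :
    exists p, G p.1 p.2 /\ hnorm (x - p.1) < n.+1%:R^-1.
  have [|x' [y' Gxy'] xx'] := xG n.+1%:R^-1; first by rewrite invr_gt0.
  by exists (x', y').
have u1 e : 0 < e -> exists N, forall n, (N <= n)%N -> hnorm (x - (u n).1) < e.
  move=> /near_invS_lt[N uN]; exists N => n /uN; apply: lt_trans.
  by case: (uP n).
have [|y uy] := hilbert_complete (u := fun n => (u n).2).
  move=> e e0; have [|N uN] := u1 (e / 2); first by rewrite divr_gt0.
  exists N => m n Nm Nn; rewrite -(intertwiner_hnorm (x := (u m).1 - (u n).1)).
    rewrite (le_lt_trans (le_hdist _ x _)) // (splitr e) ltrD ?uN //.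
    by rewrite hdistC uN.
  by apply: intertwinerB; [exact: (uP m).1|exact: (uP n).1].
exists y; apply: Gcl => e e0.
have [N uN] := u1 _ e0; have [N' uN'] := uy _ e0.
exists (u (maxn N N')).1, (u (maxn N N')).2; split; first exact: (uP _).1.
  by rewrite uN // leq_maxl.
by rewrite hdistC uN' // leq_maxr.
Qed.

End ClosedIntertwiner.

Section OrthTransfer.
Variables (H1 H2 : bimodule D) (G : H1 -> H2 -> Prop).
Hypotheses (GI : intertwiner G) (Gcl : rel_closed G).

(** Inside the range of [G], a central vector corresponds to a central vector of [H1], because
    commutators keep their norm; the norm form of orthogonality then carries over. *)
Lemma intertwiner_orth_central x y :
  G x y -> orth_compl (central H1) x -> orth_compl (central H2) y.
Proof.
move=> Gxy xc; have GI' := intertwiner_sym GI.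
have S2 := intertwiner_dom_subbimodule GI'.
have S2cl := intertwiner_dom_closed GI' (rel_closed_sym Gcl).
apply: (orth_central_in S2 S2cl); first by exists x.
apply/orth_complP => [|z [zc [w Gwz]]].
  exact: subspaceI (central_subspace _) S2.1.
rewrite -(intertwiner_hnorm GI Gxy).
rewrite -(intertwiner_hnorm GI (intertwinerB GI Gxy Gwz)).
apply: (orth_complP _ (central_subspace _)).1 => //.
apply/centralP => a; apply/hnorm_eq0; rewrite (intertwiner_defect GI _ Gwz).
by rewrite ((centralP z).1 zc) hnorm0.
Qed.

(** The partners of the whole complement of the central span form a sub-bimodule orthogonal to the
    central vectors of [H2], hence to the closed sub-bimodule that these generate. *)
Lemma intertwiner_orth_central_span x y : G x y ->
  orth_compl (central_span H1) x -> orth_compl (central_span H2) y.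
Proof.
move=> Gxy xc.
have [SC SCact] := subbimodule_orth_compl (central_span_subbimodule H1).
apply: (@orth_compl_central_span _ _ _ _
         [set y | exists2 x, orth_compl (central_span H1) x & G x y]).
- case: GI => G0 GD _ Gl Gr; split=> [|a z [w wc Gwz]].
    split=> [|c z z' [w wc Gwz] [w' wc' Gwz']].
      by exists 0 => //; apply: SC.1.
    by exists (c *: w + w'); [apply: SC.2|apply: GD].
  split; first by exists (lact a w); [apply: (SCact _ _ wc).1|apply: Gl].
  by exists (ract w a); [apply: (SCact _ _ wc).2|apply: Gr].
- move=> z [w wc Gwz]; apply: intertwiner_orth_central Gwz _.
  by move=> v vc; apply: wc; apply: central_sub_span.
by exists x.
Qed.

End OrthTransfer.

End Intertwiner.

(** * The quadratic form of the commutators and its lower bounds *)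

Section SpectralGap.
Variables (R : realType) (A : cstarType R) (D : cstar_double A).
Implicit Types (H : bimodule D) (a b : A) (d : D) (Q : {fset A}) (t : R).

Definition defect2 H Q (x : H) : R := \sum_(a <- Q) hnorm (defect a x) ^+ 2.

Lemma defect2_ge0 H Q (x : H) : 0 <= defect2 Q x.
Proof. by apply: sumr_ge0 => a _; exact: sqr_ge0. Qed.

Lemma hnorm_continuous H : continuous (@hnorm R H).
Proof.
move=> x; apply/cvgrPdist_lt => e e0; apply/nbhs_ballP.
exists e%:C; rewrite /= ?ltcR // => y.
rewrite -ball_normE /= normr_hnorm ltcR; apply: le_lt_trans.
rewrite ler_norml; have := le_hdist x y 0; have := le_hdist y x 0.
rewrite !subr0 (hdistC y); lra.
Qed.

Lemma defect_continuous H a : continuous (@defect R A D H a).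
Proof.
rewrite (_ : defect a = rep (dou_l D a - dou_r D a) :> (H -> H)).
  exact: rep_continuous.
by apply/funext => x; rewrite defectE.
Qed.

Lemma defect2_continuous H Q : continuous (@defect2 H Q).
Proof.
rewrite /defect2; elim: (enum_fset Q) => [|a s IHs].
  rewrite (_ : (fun x => _) = cst 0); first exact: cst_continuous.
  by apply/funext => x; rewrite big_nil.
rewrite (_ : (fun x => _) = fun x => hnorm (defect a x) * hnorm (defect a x)
    + \sum_(b <- s) hnorm (defect b x) ^+ 2).
  have fa : continuous (fun x : H => hnorm (defect a x)).
    move=> x; apply: (@continuous_comp _ _ _ (defect a)).
      exact: defect_continuous.
    exact: hnorm_continuous.
  move=> x; apply: (@continuousD _ _ _
    (fun x => hnorm (defect a x) * hnorm (defect a x))).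
    by apply: continuousM; apply: fa.
  exact: IHs.
by apply/funext => x; rewrite big_cons expr2.
Qed.

Definition gap_on H Q t (S : set H) : Prop :=
  forall x, S x -> t * hnorm x ^+ 2 <= defect2 Q x.

Lemma gap_closure H Q t (S : set H) : gap_on Q t S -> gap_on Q t (closure S).
Proof.
move=> Sgap x Sx.
have cl : closed [set x : H | 0 <= defect2 Q x - t * (hnorm x * hnorm x)].
  apply: (@preimage_closed _ _ _ [set r : R | 0 <= r]); last exact: closed_ge.
  move=> y _; apply: continuousB; first exact: defect2_continuous.
  apply: continuousM; first exact: cst_continuous.
  by apply: continuousM; apply: hnorm_continuous.
rewrite -subr_ge0 expr2; apply: (closedP _).1 cl _ _.
apply: closure_subset Sx => y Sy.
by rewrite /= subr_ge0 -expr2; apply: Sgap.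
Qed.

Lemma defect2_eq0 H Q (x y : H) : (forall a, defect a x = defect a y) ->
  defect2 Q x = defect2 Q y.
Proof. by move=> xy; apply: eq_bigr => a _; rewrite xy. Qed.

Lemma defect2Z H Q (c : R[i]) (x : H) :
  defect2 Q (c *: x) = Re `|c| ^+ 2 * defect2 Q x.
Proof.
rewrite mulr_sumr; apply: eq_bigr => a _.
by rewrite !defectE repZ hnormZ exprMn.
Qed.

Lemma defect2_subset H Q Q' (x : H) :
  {subset Q <= Q'} -> defect2 Q x <= defect2 Q' x.
Proof.
move=> QQ'; rewrite /defect2 [leRHS](bigID (mem Q)) /=.
rewrite -[X in _ <= X + _]big_filter [X in _ <= X + _](perm_big (enum_fset Q)).
  by rewrite lerDl sumr_ge0 // => a _; apply: sqr_ge0.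
apply: uniq_perm => [||a]; rewrite ?filter_uniq ?fset_uniq // mem_filter /=.
by apply/andP/idP => [[]//|Qa]; split; rewrite // QQ'.
Qed.

Lemma defect2D H Q (x y : H) : (forall a, inner (defect a x) (defect a y) = 0) ->
  defect2 Q (x + y) = defect2 Q x + defect2 Q y.
Proof.
move=> xy; rewrite -big_split; apply: eq_bigr => a _ /=.
by rewrite -pythagoras // -{1}[x]scale1r defect_linear scale1r.
Qed.

Lemma intertwiner_defect2 H1 H2 (G : H1 -> H2 -> Prop) Q x y :
  intertwiner G -> G x y -> defect2 Q x = defect2 Q y.
Proof.
move=> GI Gxy; apply: eq_bigr => a _.
by rewrite (intertwiner_defect GI a Gxy).
Qed.

Lemma defect_proj_central H a (x : H) :
  defect a (x - proj_central x) = defect a x.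
Proof.
have [pc _] := orth_projP x (central_subspace H) (central_closed (H := H)).
by rewrite defectB ((centralP _).1 pc) subr0.
Qed.

(** Projecting [proj_central x] further to [S] gives a central vector whose difference from [x] is
    still orthogonal to the central vectors; by uniqueness nothing was moved. *)
Lemma proj_central_in H (S : set H) x : subbimodule S -> closed S ->
  S x -> S (proj_central x).
Proof.
move=> SS Scl Sx.
have [pc xp] := orth_projP x (central_subspace H) (central_closed (H := H)).
have [Sp pp] := orth_projP (proj_central x) SS.1 Scl.
rewrite {1}/proj_central.
rewrite (@orth_proj_uniq _ _ _ _ (orth_proj S (proj_central x))) //.
- exact: central_subspace.
- exact: central_closed.
- exact: orth_proj_central.
apply: (orth_central_in SS Scl); first exact: subspaceB SS.1 _ _.
move=> z [zc Sz]; rewrite -(subrKA (proj_central x)) linearDl /=.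
by rewrite xp // add0r pp.
Qed.

Lemma gap_proj_central H Q t (S : set H) x : subbimodule S -> closed S ->
  gap_on Q t (S `&` orth_compl (central H)) -> S x ->
  t * hnorm (x - proj_central x) ^+ 2 <= defect2 Q x.
Proof.
move=> SS Scl Sgap Sx.
rewrite -(defect2_eq0 Q (fun a => defect_proj_central a x)); apply: Sgap.
split; first exact: subspaceB SS.1 Sx (proj_central_in SS Scl Sx).
exact: (orth_projP x (central_subspace H) (central_closed (H := H))).2.
Qed.

End SpectralGap.

(** * Orthogonal sums of closed sub-bimodules *)

Section OrthogonalSum.
Variables (R : realType) (A : cstarType R) (D : cstar_double A).
Variables (H : bimodule D) (S1 S2 : set H).
Hypotheses (S1b : subbimodule S1) (S1cl : closed S1).
Hypotheses (S2b : subbimodule S2) (S2cl : closed S2).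
Hypothesis S12 : S2 `<=` orth_compl S1.

(** For [S2] orthogonal to [S1] this is their sum; describing it by the component off [S1] makes it
    closed at once, as a preimage under a contraction. *)
Definition orth_sum : set H := [set x | S2 (x - orth_proj S1 x)].

Lemma orth_sum_subl : S1 `<=` orth_sum.
Proof.
move=> x S1x; rewrite /orth_sum /= (@orth_proj_uniq _ _ _ x x S1b.1) // subrr.
  exact: S2b.1.1.
exact: (orth_compl_subspace S1).1.
Qed.

Lemma orth_sum_subbimodule : subbimodule orth_sum.
Proof.
split=> [|a x Sx].
  split=> [|a x y Sx Sy]; first by apply: orth_sum_subl; exact: S1b.1.1.
  rewrite /orth_sum /= orth_proj_linear //; last exact: S1b.1.
  by rewrite opprD addrACA -scalerBr; apply: S2b.1.2.
rewrite /orth_sum /= orth_proj_lact // orth_proj_ract // -!repB.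
exact: S2b.2.
Qed.

Lemma orth_sum_closed : closed orth_sum.
Proof.
apply/closedP => x /closureP Sx; apply: (closedP _).1 S2cl _ _.
apply/closureP => e /Sx[y Sy xy]; exists (y - orth_proj S1 y) => //.
apply: le_lt_trans xy.
rewrite [X in hnorm X](_ : _ = x - y - orth_proj S1 (x - y)).
  exact: le_hnorm_orth_compl S1b.1 _.
by rewrite (orth_projB _ _ S1b.1 S1cl) [in RHS]opprD [RHS]addrACA -opprD.
Qed.

(** Both components of [x] and their commutators stay in the orthogonal pieces, so Pythagoras splits
    both sides and [t] is not diminished. *)
Lemma orth_sum_gap (Q : {fset A}) (t : R) :
  gap_on Q t (S1 `&` orth_compl (central H)) ->
  gap_on Q t (S2 `&` orth_compl (central H)) ->
  gap_on Q t (orth_sum `&` orth_compl (central H)).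
Proof.
move=> S1gap S2gap x [Sx xc].
have [S1p xp] := orth_projP x S1b.1 S1cl.
set p := orth_proj S1 x in S1p xp *; set w := x - p in xp *.
have S2w : S2 w by [].
have xE : x = p + w by rewrite addrC subrK.
(* Against a central vector of [S1], [p] and [x] have the same inner product, since [w] is
   orthogonal to [S1]. *)
have pc : orth_compl (central H) p.
  apply: (orth_central_in S1b) => // z [zc S1z].
  by have := xc z zc; rewrite {1}xE linearDl /= xp // addr0.
have wc : orth_compl (central H) w.
  by apply: subspaceB (orth_compl_subspace _) xc pc.
rewrite xE pythagoras; last exact/inner_eq0C/xp.
rewrite defect2D; last first.
  move=> a; apply: inner_eq0C; apply: S12.
    exact: subspaceB S2b.1 (S2b.2 a w S2w).1 (S2b.2 a w S2w).2.
  exact: subspaceB S1b.1 (S1b.2 a p S1p).1 (S1b.2 a p S1p).2.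
by rewrite mulrDr; apply: lerD; [apply: S1gap|apply: S2gap].
Qed.

End OrthogonalSum.

(** * Kazhdan constants, spectral gaps and almost central unit vectors *)

Section Kazhdan.
Variables (R : realType) (A : cstarType R) (D : cstar_double A).
Implicit Types (H : bimodule D) (Q : {fset A}) (t : R).

Lemma exists_normalized H (x : H) : x != 0 -> exists e : H,
  [/\ hnorm e = 1, x = (hnorm x)%:C *: e & e = (hnorm x)^-1%:C *: x].
Proof.
move=> x0; have hx := hnorm_gt0 x0; exists ((hnorm x)^-1%:C *: x); split=> //.
  by rewrite hnormZr ger0_norm ?invr_ge0 ?ltW // mulVf ?gt_eqF.
by rewrite scalerA -(rmorphM (real_complex R)) divff ?gt_eqF // scale1r.
Qed.

Lemma gap_on_unit H Q t (S : set H) : subspace S ->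
  (forall x, S x -> hnorm x = 1 -> t <= defect2 Q x) -> gap_on Q t S.
Proof.
move=> SS Sunit x Sx; have [->|x0] := eqVneq x 0.
  by rewrite hnorm0 expr0n mulr0 defect2_ge0.
have [e [e1 xE eE]] := exists_normalized x0; have hx := hnorm_gt0 x0.
rewrite {2}xE defect2Z Re_normr_real real_normK ?num_real // mulrC.
rewrite ler_pM2l ?exprn_gt0 //; apply: Sunit => //.
by rewrite eE; exact: subspaceZ.
Qed.

Lemma kazhdan_sup_gt0 H (S : set H) : (0 < kazhdan_sup S)%E <->
  exists Q t, [/\ Q != fset0, 0 < t & gap_on Q t (orth_compl S)].
Proof.
split=> [|[Q [t [Q0 t0 Sgap]]]]; last first.
  apply: (@lt_le_trans _ _ (Num.sqrt t)%:E); first by rewrite lte_fin sqrtr_gt0.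
  apply: (@le_trans _ _ (kazhdan Q S)); last by apply: ereal_sup_ubound; exists Q.
  apply/ereal_infP => _ [x [xS x1] <-]; rewrite lee_fin ler_sqrt.
    by have := Sgap x xS; rewrite x1 expr1n mulr1.
  exact: defect2_ge0.
move=> /ereal_sup_gt[_ [Q Q0 <-] k0].
have [r r0 rk] : exists2 r : R, 0 < r & (r%:E <= kazhdan Q S)%E.
  (* The value is infinite when the complement of [S] has no unit vector; any positive bound then
     serves. *)
  case: (kazhdan Q S) k0 => [r r0|_|//]; first by exists r.
  by exists 1; rewrite ?ltr01 // leey.
exists Q, (r ^+ 2); split => //; first by rewrite exprn_gt0.
apply: gap_on_unit; first exact: orth_compl_subspace.
move=> x xS x1.
rewrite -(sqr_sqrtr (defect2_ge0 Q x)) ler_pXn2r ?nnegrE ?sqrtr_ge0 ?(ltW r0) //.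
rewrite -lee_fin (le_trans rk) //; apply: ereal_inf_lbound.
by exists x.
Qed.

(** The choice of [delta] precedes [H], which is what makes the later conclusions uniform over all
    bimodules. *)
Lemma almost_central_small Q t : 0 < t -> exists2 delta : R, 0 < delta &
  forall H x, almost_central H Q delta x -> defect2 Q x < t.
Proof.
(* One more than the size of [Q], so that the sum of the bounds [t / n] is strictly below [t]. *)
move=> t0; pose n : R := (size (enum_fset Q)).+1%:R.
have n0 : 0 < n by rewrite ltr0n.
exists (Num.sqrt (t / n)) => [|H x [_ xQ]]; first by rewrite sqrtr_gt0 divr_gt0.
apply: (@le_lt_trans _ _ (\sum_(a <- Q) t / n)).
  rewrite /defect2 !big_seq; apply: ler_sum => a /xQ /ltW xa.
  rewrite -[leRHS](sqr_sqrtr (ltW (divr_gt0 t0 n0))).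
  by rewrite ler_pXn2r ?nnegrE ?hnorm_ge0 ?sqrtr_ge0.
rewrite big_const_seq count_predT iter_addr_0 -mulrnAr -[ltRHS]mulr1 ltr_pM2l //.
by rewrite -mulr_natl ltr_pdivrMr // mul1r ltr_nat.
Qed.

Lemma gap_almost_central H (S : set H) :
  (exists Q t, [/\ Q != fset0, 0 < t & gap_on Q t (orth_compl S)]) <->
  exists Q (delta : R), [/\ Q != fset0, 0 < delta &
    forall x, almost_central H Q delta x -> ~ orth_compl S x].
Proof.
split=> [[Q [t [Q0 t0 Sgap]]]|[Q [delta [Q0 d0 Qd]]]].
  have [delta d0 small] := almost_central_small Q t0.
  exists Q, delta; split=> // x xQ xS; have := small H x xQ.
  by rewrite ltNge; have := Sgap x xS; rewrite xQ.1 expr1n mulr1 => ->.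
(* A sum of squares below [delta^2] has every term below it, so such a unit vector would be almost
   central. *)
exists Q, (delta ^+ 2); split=> //; first by rewrite exprn_gt0.
apply: gap_on_unit; first exact: orth_compl_subspace.
move=> x xS x1; rewrite leNgt; apply/negP => small.
apply: (Qd x) => //; split=> // a Qa.
rewrite -(@ltr_pXn2r _ 2) ?nnegrE ?hnorm_ge0 ?(ltW d0) //.
apply: le_lt_trans small; rewrite /defect2 (big_rem a) //= lerDl.
by apply: sumr_ge0 => b _; exact: sqr_ge0.
Qed.

End Kazhdan.

(** * Cyclic sub-bimodules and the GNS bimodules of states and traces *)

Section VectorStates.
Variables (R : realType) (A : cstarType R) (D : cstar_double A).
Implicit Types (H M K : bimodule D) (a b : A) (d : D).

Lemma hnorm_inner H1 H2 (x : H1) (y : H2) :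
  inner x x = inner y y -> hnorm x = hnorm y.
Proof.
rewrite !innerxx => /complexI/eqP; rewrite eqrXn2 ?hnorm_ge0 // => /eqP.
exact.
Qed.

Definition vector_state H (xi : H) : D -> R[i] := fun d => inner (rep d xi) xi.

Lemma inner_vector_state H (xi : H) d e :
  inner (rep d xi) (rep e xi) = vector_state xi (star e * d).
Proof. by rewrite /vector_state repM [RHS]rep_star starK. Qed.

Lemma vector_state_is_state H (xi : H) :
  hnorm xi = 1 -> is_state (vector_state xi).
Proof.
move=> xi1; split=> [c d e|d|].
- by rewrite /vector_state rep_linearl linearDl linearZl_LR.
- by rewrite -inner_vector_state innerxx ler0c sqr_ge0.
- by rewrite /vector_state rep1 innerxx xi1 expr1n.
Qed.

(** No density of the range of [L] is asked, so [M] may be the GNS bimodule itself or any bimodule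
    containing a copy of it. *)
Lemma gns_intertwiner H M (xi : H) (L : D -> M) : linear L ->
    (forall d e, inner (L d) (L e) = vector_state xi (star e * d)) ->
    (forall d e, rep d (L e) = L (d * e)) ->
  exists G : H -> M -> Prop,
    [/\ intertwiner G, rel_closed G & forall d, G (rep d xi) (L d)].
Proof.
move=> Llin Linner Lrep.
apply: (@intertwiner_of_maps _ _ _ D _ _ (fun d => rep d xi) L
  (fun a d => dou_l D a * d) (fun a d => dou_r D a * d)) => //.
- by move=> c d e; rewrite rep_linearl.
- by move=> d; apply: hnorm_inner; rewrite inner_vector_state Linner.
- by move=> a d; rewrite repM /lact Lrep.
- by move=> a d; rewrite repM /ract Lrep.
Qed.

Lemma universal_intertwiner H K (xi : H) :
    universal_bimodule K -> hnorm xi = 1 ->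
  exists G : H -> K -> Prop,
    [/\ intertwiner G, rel_closed G & exists y, G xi y].
Proof.
move=> [M [Mgns [u [ulin urep uinner _ _]]]] xi1.
pose tau : state D := exist _ _ (vector_state_is_state xi1).
have [L [Llin Linner _ Lrep]] := Mgns tau.
have [|d e|d e|G [GI Gcl GL]] := @gns_intertwiner H K xi (u tau \o L).
- by move=> c d e; rewrite /= Llin ulin.
- by rewrite /= uinner Linner.
- by rewrite /= -urep Lrep.
exists G; split=> //; exists (u tau (L 1)).
by rewrite -[xi]rep1; apply: GL.
Qed.

Definition central_trace H (xi : H) : A -> R[i] :=
  fun a => inner (lact a xi) xi.

Lemma inner_central_trace H (xi : H) a b :
  inner (lact a xi) (lact b xi) = central_trace xi (star b * a).
Proof. by rewrite /central_trace lactM [RHS]inner_lact starK. Qed.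

Lemma central_trace_is_state H (xi : H) : hnorm xi = 1 ->
  is_state (central_trace xi).
Proof.
move=> xi1; split=> [c a b|a|].
- by rewrite /central_trace /lact linearP rep_linearl linearDl linearZl_LR.
- by rewrite -inner_central_trace innerxx ler0c sqr_ge0.
- by rewrite /central_trace lact1 innerxx xi1 expr1n.
Qed.

(** Here [b.xi] becomes [xi.b], the right action moves to the other side of the inner product as
    [xi.b^*], and centrality turns it back into [b^*.xi]. *)
Lemma central_traceC H (xi : H) a b : central H xi ->
  central_trace xi (a * b) = central_trace xi (b * a).
Proof.
move=> xic; rewrite /central_trace !lactM xic lact_ract inner_ract -xic.
by rewrite [RHS]inner_lact.
Qed.

(** For central [xi] one has [a.xi.b = (a b).xi], so the cyclic bimodule is parametrized by [A]
    alone, with right action given by right multiplication. *)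
Lemma standard_intertwiner H K (xi : H) :
    standard_bimodule K -> central H xi -> hnorm xi = 1 ->
  exists G : H -> K -> Prop,
    [/\ intertwiner G, rel_closed G & exists y, G xi y].
Proof.
move=> [M [Mgns [u [ulin urep uinner _ _]]]] xic xi1.
pose tau : tracial_state A := exist _ _ (conj (central_trace_is_state xi1)
  (fun a b => central_traceC a b xic)).
have [L [Llin Linner _ Lact]] := Mgns tau.
have [||a|a b|a b|G [GI Gcl GL]] := @intertwiner_of_maps _ _ D A H K
  (fun a => lact a xi) (u tau \o L) (fun a b => a * b) (fun a b => b * a).
- by move=> c a b; rewrite /lact linearP rep_linearl.
- by move=> c a b; rewrite /= Llin ulin.
- by apply: hnorm_inner; rewrite inner_central_trace /= uinner Linner.
- by rewrite lactM /= /lact -urep -(Lact _ _).1.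
- by rewrite lactM xic lact_ract /= /ract -urep -(Lact _ _).2.
exists G; split=> //; exists (u tau (L 1)).
by rewrite -[xi]lact1; apply: GL.
Qed.

End VectorStates.

(** * From the standard bimodule to the span of the central vectors *)

Section CentralSpanGap.
Variables (R : realType) (A : cstarType R) (D : cstar_double A).
Implicit Types (H K : bimodule D) (Q : {fset A}) (t : R).

Definition gap_submodule H Q t (S : set H) : Prop :=
  [/\ subbimodule S, closed S & gap_on Q t (S `&` orth_compl (central H))].

(* Quantifying over all S makes the extendable vectors a sub-bimodule, which
   replaces a maximal orthogonal family of cyclic sub-bimodules. *)
Definition gap_extendable H Q t (x : H) : Prop :=
  forall S, gap_submodule Q t S ->
  exists S', [/\ gap_submodule Q t S', S `<=` S' & S' x].

Lemma gap_extendable_subbimodule H Q t :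
  subbimodule (gap_extendable (H := H) Q t).
Proof.
split=> [|a x xext].
  split=> [S [SS Scl Sgap]|c x y xext yext S].
    by exists S; split=> //; exact: SS.1.1.
  move=> /xext[S1 [/yext[S2 [S2g S12 S2y]] SS1 S1x]].
  exists S2; split=> //; first exact: subset_trans S12.
  by case: S2g => S2b _ _; apply: S2b.1.2 => //; apply: S12.
by split=> S /xext[S' [S'g SS' S'x]]; exists S'; split=> //;
  case: S'g => S'b _ _; [apply: (S'b.2 a x S'x).1|apply: (S'b.2 a x S'x).2].
Qed.

(** The part of [x] off [S] is central; normalized to [e], it lies in a closed sub-bimodule
    equivalent to one of [K], which brings the gap along. Adding that piece to [S] captures [x]. *)
Lemma central_gap_extendable H K Q t : standard_bimodule K ->
    gap_on Q t (orth_compl (central K)) ->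
  central H `<=` gap_extendable (H := H) Q t.
Proof.
move=> hK Kgap x xc S [SS Scl Sgap].
have [Sp xp] := orth_projP x SS.1 Scl.
have [x0|x0] := eqVneq (x - orth_proj S x) 0.
  by exists S; split=> //; rewrite (subr0_eq x0).
have [e [e1 xE eE]] := exists_normalized x0.
have ec : central H e.
  rewrite eE; apply: (subspaceZ _ (central_subspace H)).
  exact: subspaceB (central_subspace H) xc (orth_proj_central SS Scl xc).
have eS : orth_compl S e.
  by rewrite eE; apply: (subspaceZ _ (orth_compl_subspace S)).
have [G [GI Gcl [y Gey]]] := standard_intertwiner hK ec e1.
(* The domain of [G] is only known to contain [e]; cutting it by the complement of [S] ensures
   orthogonality and keeps [e]. *)
pose W := intertwiner_dom G `&` orth_compl S.
have Wb : subbimodule W.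
  have [domS dom_act] := intertwiner_dom_subbimodule GI.
  have [S'S S'act] := subbimodule_orth_compl SS.
  split=> [|a w [/(dom_act a)[dl dr] /(S'act a)[Sl Sr]]]; last by split; split.
  exact: subspaceI.
have Wcl : closed W.
  apply: closedI; first exact: intertwiner_dom_closed.
  exact: orth_compl_closed SS.1.
have WS : W `<=` orth_compl S by move=> w [].
exists (orth_sum S W); split.
- split; [exact: orth_sum_subbimodule|exact: orth_sum_closed|].
  apply: orth_sum_gap => // w [[[z Gwz] _] wc].
  rewrite (intertwiner_hnorm GI Gwz) (intertwiner_defect2 Q GI Gwz).
  exact/Kgap/(intertwiner_orth_central GI Gcl Gwz).
- exact: orth_sum_subl.
- rewrite /orth_sum /= xE; apply: (subspaceZ _ Wb.1).
  by split=> //; exists y.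
Qed.

Lemma central_span_gap H K Q t : standard_bimodule K ->
    gap_on Q t (orth_compl (central K)) ->
  gap_on Q t (central_span H `&` orth_compl (central H)).
Proof.
move=> hK Kgap x [xspan xc].
pose U := gap_extendable (H := H) Q t.
have Ub : subbimodule U := gap_extendable_subbimodule H Q t.
have Ugap : gap_on Q t [set y - proj_central y | y in U].
  move=> _ [y yU <-].
  (* Extending the zero sub-bimodule puts [y] in some closed sub-bimodule with the gap. *)
  have [|S [[SS Scl Sgap] _ Sy]] := yU [set 0].
    split; last first.
    - by move=> z [-> _]; rewrite hnorm0 expr0n mulr0; exact: defect2_ge0.
    - exact: closed_set0.
    - split=> [|a z ->]; last by rewrite /lact /ract !rep0.
      by split=> // c z z' -> ->; rewrite scaler0 addr0.
  rewrite (defect2_eq0 Q (fun a => defect_proj_central a y)).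
  exact: gap_proj_central Sgap Sy.
apply: (gap_closure Ugap); apply/closureP => e e0.
have [|y Uy xy] := (closureP U x).1 _ e e0.
  apply: xspan; [exact: subbimodule_closure|exact: closed_closure|].
  apply: subset_trans (@subset_closure _ U).
  exact: central_gap_extendable hK Kgap.
(* As [x] has zero central projection, removing that of [y] does not increase the distance to
   [x]. *)
exists (y - proj_central y); first by exists y.
have := le_hnorm_orth_compl (x - y) (central_subspace H)
  (central_closed (H := H)).
rewrite orth_projB; [|exact: central_subspace|exact: central_closed].
have -> : orth_proj (central H) x = 0.
  apply: orth_proj_uniq; rewrite ?subr0 //.
  - exact: central_subspace.
  - exact: central_closed.
  - exact: (central_subspace H).1.
rewrite sub0r opprK => /le_lt_trans /(_ xy).
by rewrite opprB addrCA [X in hnorm X]addrC.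
Qed.

End CentralSpanGap.

(** * Square roots near 1 in a C*-algebra *)

Section SquareRoot.
Variables (R : realType) (B : cstarType R).
Implicit Types x y z h : B.

Lemma cnormZr (t : R) x : cnorm (t%:C *: x) = `|t| * cnorm x.
Proof. by rewrite cnormZ Re_normr_real. Qed.

Lemma cnormN x : cnorm (- x) = cnorm x.
Proof. by rewrite -scaleN1r cnormZ normrN1 mul1r. Qed.

Lemma cdistC x y : cnorm (x - y) = cnorm (y - x).
Proof. by rewrite -cnormN opprB. Qed.

Lemma cnorm0 : cnorm (0 : B) = 0.
Proof. by rewrite -(scale0r (0 : B)) cnormZ normr0 mul0r. Qed.

Lemma cnorm_ge0 x : 0 <= cnorm x.
Proof.
have := cnormD x (- x); rewrite subrr cnorm0 cnormN -mulr2n.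
by rewrite pmulrn_lge0.
Qed.

Lemma starB x y : star (x - y) = star x - star y.
Proof. by rewrite -scaleN1r starD starZ rmorphN1 scaleN1r. Qed.

Lemma star0 : star (0 : B) = 0.
Proof. by rewrite -(subrr (0 : B)) starB !subrr. Qed.

Lemma star1 : star (1 : B) = 1.
Proof. by have := starM (star 1 : B) 1; rewrite starK !mulr1 starK. Qed.

Lemma le_cdist_sqr x y (r : R) : cnorm x <= r -> cnorm y <= r ->
  cnorm (x * x - y * y) <= 2 * r * cnorm (x - y).
Proof.
move=> xr yr; have -> : x * x - y * y = x * (x - y) + (x - y) * y.
  by rewrite mulrBr mulrBl subrKA.
have := cnormD (x * (x - y)) ((x - y) * y).
have := cnormM x (x - y); have := cnormM (x - y) y.
have := cnorm_ge0 (x - y); move: xr yr; nra.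
Qed.

(* The square root is [1 - z] for the fixed point [z] of the contraction
   [z |-> (h + z ^ 2) / 2]. *)
Lemma selfadjoint_sqrt_1B h : star h = h -> cnorm h <= 2^-1 ->
  exists2 z, star z = z & (1 - z) * (1 - z) = 1 - h.
Proof.
move=> hs h2; pose half : R[i] := (2^-1 : R)%:C.
have half_ge0 : 0 <= 2^-1 :> R by rewrite invr_ge0.
pose u n := iter n (fun z => half *: (h + z * z)) (0 : B).
have uS n : u n.+1 = half *: (h + u n * u n) by [].
have u2 n : cnorm (u n) <= 2^-1.
  elim: n => [|n IHn]; first by rewrite cnorm0.
  rewrite uS cnormZr ger0_norm //.
  have := cnormD h (u n * u n); have := cnormM (u n) (u n).
  have := cnorm_ge0 (u n); move: h2 IHn; nra.
have us n : star (u n) = u n.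
  elim: n => [|n IHn]; first exact: star0.
  by rewrite uS starZ starD starM hs IHn [Num.conj half]conjc_real.
(* On the ball of radius 1/2 squaring is 1-Lipschitz, so the iterated map contracts by 1/2. *)
have u_contr (n k : nat) : cnorm (u (n + k)%N - u n) <= 2^-1 ^+ n.
  elim: n => [|n IHn].
    by rewrite -[u 0%N]/(0 : B) subr0 expr0; have := u2 k; rewrite add0n; lra.
  rewrite addSn !uS -scalerBr opprD addrACA subrr add0r cnormZr ger0_norm //.
  have := le_cdist_sqr (u2 (n + k)%N) (u2 n); rewrite exprS.
  move: IHn; lra.
have half_small (e : R) : 0 < e -> exists N, 2^-1 ^+ N < e.
  move=> /near_invS_lt[N /(_ N (leqnn N)) Ne]; exists N.
  apply: le_lt_trans Ne; rewrite exprVn -natrX lef_pV2 ?posrE ?ltr0n ?expn_gt0 //.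
  by rewrite ler_nat ltn_expl.
have [e e0|z uz] := @cnorm_complete R B u.
  have [|N Ne] := half_small (e / 2); first by rewrite divr_gt0.
  exists N => m n Nm Nn.
  have := u_contr N (m - N)%N; have := u_contr N (n - N)%N; rewrite !subnKC //.
  have := cnormD (u m - u N) (u N - u n); rewrite subrKA (cdistC (u N)).
  move: Ne; lra.
have z_small (e : R) : 0 < e ->
    exists2 n, cnorm (u n - z) < e & cnorm (u n.+1 - z) < e.
  by move=> /uz[N uN]; exists N; apply: uN.
exists z.
  apply/subr0_eq/cnorm_eq0/eqP; rewrite eq_le cnorm_ge0 andbT.
  apply/ler_addgt0Pr => e e0; have [|n un _] := z_small (e / 2).
    by rewrite divr_gt0.
  have := cnormD (star z - u n) (u n - z); rewrite subrKA.
  rewrite -{1}(us n) -starB cnorm_starr cdistC; move: un; lra.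
have z1 : cnorm z <= 1.
  have [|n un _] := z_small 2^-1; first by rewrite invr_gt0.
  have := cnormD (z - u n) (u n); rewrite subrK cdistC; have := u2 n.
  move: un; lra.
have zE : z = half *: (h + z * z).
  apply/subr0_eq/cnorm_eq0/eqP; rewrite eq_le cnorm_ge0 andbT.
  apply/ler_addgt0Pr => e e0; have [|n un un1] := z_small (e / 2).
    by rewrite divr_gt0.
  have := cnormD (z - u n.+1) (u n.+1 - half *: (h + z * z)); rewrite subrKA.
  rewrite {2}uS -scalerBr opprD addrACA subrr add0r cnormZr ger0_norm //.
  have := le_cdist_sqr (_ : cnorm (u n) <= 1) z1.
  have := u2 n; rewrite (cdistC z); move: un un1 => un un1 un2.
  by move=> /(_ _)/wrap[]; lra.
have {}zE : z + z = h + z * z.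
  rewrite {1 2}zE -scalerDl -(rmorphD (real_complex R)).
  by rewrite (_ : 2^-1 + 2^-1 = 1 :> R) ?scale1r //; field.
by rewrite mulrBr mulr1 mulrBl mul1r -addrA -opprD addrA zE addrK.
Qed.

End SquareRoot.

(** * Norm control of representations and invariance under A^Dou *)

Section Representations.
Variables (R : realType) (A : cstarType R) (D : cstar_double A).
Variable H : bimodule D.
Implicit Types (x : H) (d e : D).

Lemma repBl d e x : rep (d - e) x = rep d x - rep e x.
Proof. by rewrite addrC -scaleN1r rep_linearl scaleN1r addrC. Qed.

Lemma rep0l x : rep 0 x = 0.
Proof. by rewrite -(subrr (0 : D)) repBl subrr. Qed.

Lemma rep_suml n (F : 'I_n -> D) x :
  rep (\sum_(i < n) F i) x = \sum_(i < n) rep (F i) x.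
Proof.
elim/big_ind2: _ => [|_ y _ z <- <-|//]; first exact: rep0l.
by rewrite -[y]scale1r rep_linearl !scale1r.
Qed.

Lemma repZl (c : R[i]) d x : rep (c *: d) x = c *: rep d x.
Proof. by rewrite -[c *: d]addr0 rep_linearl rep0l addr0. Qed.

Lemma inner_rep_star d x :
  inner (rep (star d * d) x) x = (hnorm (rep d x) ^+ 2)%:C.
Proof. by rewrite repM rep_star starK innerxx. Qed.

(** With [c = 1 / (2 |d|^2)] the element [c d^* d] has norm at most 1/2, so [1 - c d^* d] is the
    square of a self-adjoint element and acts positively: [c |d x|^2 <= |x|^2]. The resulting
    factor, the square root of 2, is rounded up to 2; only linearity in [cnorm d] matters. *)
Lemma hnorm_rep_le d x : hnorm (rep d x) <= 2 * cnorm d * hnorm x.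
Proof.
have [d0|d0] := eqVneq (cnorm d) 0.
  by rewrite (cnorm_eq0 d d0) rep0l hnorm0 cnorm0 mulr0 mul0r.
have {}d0 : 0 < cnorm d by rewrite lt_neqAle eq_sym d0 cnorm_ge0.
pose c := (2 * cnorm d ^+ 2)^-1.
have c0 : 0 < c by rewrite invr_gt0 mulr_gt0 // exprn_gt0.
pose h := c%:C *: (star d * d).
have [||z zs zE] := @selfadjoint_sqrt_1B _ _ h.
- by rewrite /h starZ starM starK [Num.conj _]conjc_real.
- rewrite /h cnormZr gtr0_norm // cnorm_star /c invfM mulfVK // gt_eqF //.
  by rewrite exprn_gt0.
have := sqr_ge0 (hnorm (rep (1 - z) x)).
have -> : hnorm (rep (1 - z) x) ^+ 2 = hnorm x ^+ 2 - c * hnorm (rep d x) ^+ 2.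
  apply: complexI; rewrite -inner_rep_star starB zs star1 zE repBl rep1 repZl.
  rewrite linearBl linearZl_LR /= inner_rep_star innerxx.
  by rewrite [RHS]rmorphB [X in _ = _ - X]rmorphM.
rewrite subr_ge0 -ler_pdivlMl // invrK => le2.
rewrite -(@ler_pXn2r _ 2) ?nnegrE ?mulr_ge0 ?hnorm_ge0 ?cnorm_ge0 //.
apply: le_trans le2 _; rewrite !exprMn ler_wpM2r ?sqr_ge0 //.
by rewrite ler_wpM2r ?sqr_ge0 // expr2; lra.
Qed.

Lemma subbimodule_rep (S : set H) d x : subbimodule S -> closed S ->
  S x -> S (rep d x).
Proof.
move=> SS Scl Sx; apply: (closedP _).1 Scl _ _; apply/closureP => e e0.
have [_ _ approx _] := dou_max_tensor D.
have C0 : 0 < 2 * hnorm x + 1 by rewrite ltr_wpDl // mulr_ge0 // hnorm_ge0.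
have [|n [a [b dab]]] := approx d (e / (2 * hnorm x + 1)).
  by rewrite divr_gt0.
exists (rep (\sum_(i < n) dou_l D (a i) * dou_r D (b i)) x).
  rewrite rep_suml; apply: subspace_sum SS.1 _ => i; rewrite repM.
  by apply: (SS.2 _ _ _).1; apply: (SS.2 _ _ Sx).2.
rewrite -repBl (le_lt_trans (hnorm_rep_le _ _)) //.
move: dab; rewrite ltr_pdivlMr //; apply: le_lt_trans.
have := cnorm_ge0 (d - \sum_(i < n) dou_l D (a i) * dou_r D (b i)); lra.
Qed.

End Representations.

(** * Transfer of gaps between bimodules, and property (T) *)

Section KazhdanConstants.
Variables (R : realType) (A : cstarType R) (D : cstar_double A).
Implicit Types (H M K : bimodule D) (Q : {fset A}) (t : R).

Lemma dense_closure H (S : set H) x : dense S -> closure S x.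
Proof.
move=> Sd B /nbhs_interior Bx.
have [|y [By Sy]] := Sd (interior B) _ (open_interior B).
  by exists x; apply: nbhs_singleton.
by exists y; split=> //; apply: interior_subset.
Qed.

(** The class of 1 is central, and its left translates are the dense range of [L]. *)
Lemma tracial_gns_central_span M (tau : A -> R[i]) x :
  is_tracial_gns M tau -> central_span M x.
Proof.
move=> [L [_ _ Ldense Lact]].
apply: ((closedP _).1 (@central_span_closed _ _ _ M)).
apply: closure_subset (dense_closure Ldense) => _ [a _ <-].
have L1 : central M (L 1).
  by move=> b; have [-> ->] := Lact b 1; rewrite mulr1 mul1r.
rewrite -[a]mulr1 -(Lact a 1).1.
exact: ((central_span_subbimodule M).2 _ _ (central_sub_span L1)).1.
Qed.

(** The preimage of the central span of [H] under each embedding is a closed sub-bimodule containing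
    the central vectors of [M i], hence everything. *)
Lemma hilbert_sum_central_span (I : Type) (M : I -> bimodule D) H :
    hilbert_sum M H -> (forall i x, central_span (M i) x) ->
  forall x, central_span H x.
Proof.
move=> [u [ulin urep uinner _ total]] Mspan.
have [spanS span_act] := central_span_subbimodule H.
apply: total => [||i v]; [exact: spanS|exact: central_span_closed|].
have u0 : u i 0 = 0.
  by have := ulin i (-1) 0 0; rewrite scaler0 addr0 scaleN1r addNr.
have uB x y : u i (x - y) = u i x - u i y.
  by rewrite addrC -scaleN1r ulin scaleN1r addrC.
apply: (Mspan i v [set w | central_span H (u i w)]).
- split=> [|a w wS].
    split=> [|c w w' wS wS']; first by rewrite /= u0; exact: spanS.1.
    by rewrite /= ulin; apply: spanS.2.
  by rewrite /lact /ract /= !urep; apply: span_act.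
- apply/closedP => w /closureP wS.
  apply: ((closedP _).1 (@central_span_closed _ _ _ H)).
  apply/closureP => e /wS[w' w'S ww']; exists (u i w') => //.
  by rewrite -uB (hnorm_inner (uinner i _ _)).
- move=> w wc; apply: central_sub_span => a.
  by rewrite /lact /ract -!urep; congr (u i _); apply: wc.
Qed.

Lemma quasi_standard_central_span H x :
  quasi_standard_bimodule H -> central_span H x.
Proof.
move=> [alpha [M [N [Mgns NM HN]]]].
apply: (hilbert_sum_central_span HN) => tau.
apply: (hilbert_sum_central_span (NM tau)) => _ y.
exact: tracial_gns_central_span (Mgns tau).
Qed.

Lemma standard_quasi_standard K :
  standard_bimodule K -> quasi_standard_bimodule K.
Proof.
move=> [M [Mgns KM]]; exists (fun=> unit), M, M; split=> // tau.
exists (fun _ => id); split=> //; first by case; case.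
by move=> S _ _ Su x; exact: (Su tt).
Qed.

Lemma gap_on_sub H Q Q' t t' (S S' : set H) : {subset Q <= Q'} -> t' <= t ->
  S' `<=` S -> gap_on Q t S -> gap_on Q' t' S'.
Proof.
move=> QQ' tt' SS' Sgap x /SS' /Sgap gx.
apply: le_trans (le_trans gx (defect2_subset x QQ')).
by rewrite ler_wpM2r ?sqr_ge0.
Qed.

Lemma orth_central_span_sub H :
  orth_compl (central_span H) `<=` orth_compl (central H).
Proof. by move=> x xS z zc; apply: xS; apply: central_sub_span. Qed.

Lemma universal_gap H K Q t : universal_bimodule K ->
    gap_on Q t (orth_compl (central K)) ->
  gap_on Q t (orth_compl (central H)).
Proof.
move=> hK Kgap; apply: gap_on_unit => [|x xc x1].
  exact: orth_compl_subspace.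
have [G [GI Gcl [y Gxy]]] := universal_intertwiner hK x1.
rewrite (intertwiner_defect2 Q GI Gxy).
have := Kgap y (intertwiner_orth_central GI Gcl Gxy xc).
by rewrite -(intertwiner_hnorm GI Gxy) x1 expr1n mulr1.
Qed.

Lemma universal_span_gap H K Q t : universal_bimodule K ->
    gap_on Q t (orth_compl (central_span K)) ->
  gap_on Q t (orth_compl (central_span H)).
Proof.
move=> hK Kgap; apply: gap_on_unit => [|x xc x1].
  exact: orth_compl_subspace.
have [G [GI Gcl [y Gxy]]] := universal_intertwiner hK x1.
rewrite (intertwiner_defect2 Q GI Gxy).
have := Kgap y (intertwiner_orth_central_span GI Gcl Gxy xc).
by rewrite -(intertwiner_hnorm GI Gxy) x1 expr1n mulr1.
Qed.

Lemma proj_central_eq0 H (x : H) :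
  proj_central x = 0 <-> orth_compl (central H) x.
Proof.
have [pc xp] := orth_projP x (central_subspace H) (central_closed (H := H)).
split=> [p0|xc]; first by move: xp; rewrite -/(proj_central x) p0 subr0.
apply: orth_proj_uniq; rewrite ?subr0 //.
- exact: central_subspace.
- exact: central_closed.
- exact: (central_subspace H).1.
Qed.

Lemma gap_proj_neq0 H :
  (exists Q t, [/\ Q != fset0, 0 < t & gap_on Q t (orth_compl (central H))]) <->
  exists Q (delta : R), [/\ Q != fset0, 0 < delta &
    forall x, almost_central H Q delta x -> proj_central x <> 0].
Proof.
split=> [/gap_almost_central|] [Q [delta [Q0 d0 Qd]]].
  by exists Q, delta; split=> // x /Qd xc /proj_central_eq0.
apply/gap_almost_central; exists Q, delta; split=> // x /Qd xc xo.
exact/xc/proj_central_eq0.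
Qed.

Lemma gap_proj_central_close Q t alpha : 0 < t -> 0 < alpha ->
  exists2 delta : R, 0 < delta & forall H,
    gap_on Q t (orth_compl (central H)) -> forall x : H,
    almost_central H Q delta x -> hnorm (x - proj_central x) < alpha.
Proof.
move=> t0 a0.
(* The gap is applied to [x - proj_central x], which has the same commutators as [x]; dividing by
   [t] leaves [alpha^2]. *)
have [|delta d0 small] := almost_central_small D Q (t := t * alpha ^+ 2).
  by rewrite mulr_gt0 // exprn_gt0.
exists delta => // H Hgap x /small.
rewrite -(defect2_eq0 Q (fun a => defect_proj_central a x)) => lt2.
rewrite -(@ltr_pXn2r _ 2) ?nnegrE ?hnorm_ge0 ?(ltW a0) //.
rewrite -(ltr_pM2l t0); apply: le_lt_trans lt2; apply: Hgap.
exact: (orth_projP x (central_subspace H) (central_closed (H := H))).2.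
Qed.

(* The GNS bimodule of the vector state of x in H_C^perp is cyclic, hence
   orthogonal to its own central vectors, and contradicts property (T). *)
Lemma property_T_orth_central_span K : universal_bimodule K -> property_T D ->
  exists Q (delta : R), [/\ Q != fset0, 0 < delta &
    forall H x, almost_central H Q delta x -> ~ orth_compl (central_span H) x].
Proof.
move=> [M [Mgns _]] [F [eps [F0 e0 TF]]].
exists F, eps; split=> // H x [x1 xF] xo.
pose tau : state D := exist _ _ (vector_state_is_state x1).
have [L [Llin Linner Ldense Lrep]] := Mgns tau.
have [G [GI Gcl GL]] := gns_intertwiner Llin Linner Lrep.
have GxL : G x (L 1) by rewrite -[x]rep1; apply: GL.
have [|z [zc]] := TF (M tau).
  exists (L 1); split=> [|a aF]; first by rewrite -(intertwiner_hnorm GI GxL).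
  rewrite -[_ - _]/(defect a (L 1)) -(intertwiner_defect GI a GxL).
  exact: xF.
have spanS := (central_span_subbimodule (M tau)).1.
(* Each [L d] is paired with [rep d x], which stays in the complement of the central span of [H];
   density of these classes then covers [z], which is central and so must vanish. *)
have zo : orth_compl (central_span (M tau)) z.
  apply: (closedP _).1 (orth_compl_closed spanS) _ _.
  apply: closure_subset (dense_closure Ldense) => _ [d _ <-].
  apply: (intertwiner_orth_central_span GI Gcl (GL d)).
  have spanH := central_span_subbimodule H.
  apply: subbimodule_rep xo; first exact: subbimodule_orth_compl.
  exact: orth_compl_closed spanH.1.
apply; apply/hnorm_eq0/eqP; rewrite -sqrf_eq0; apply/eqP/complexI.
by rewrite -innerxx zo //; apply: central_sub_span.
Qed.

(** Without non-zero central vectors the central span is zero and its complement is everything, so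
    no almost central vector can exist. *)
Lemma property_T_of_orth_central_span Q (delta : R) : Q != fset0 -> 0 < delta ->
    (forall H x, almost_central H Q delta x ->
      ~ orth_compl (central_span H) x) ->
  property_T D.
Proof.
move=> Q0 d0 Qd; exists Q, delta; split=> // H [x xQ].
apply: contrapT => /forallNP Hc; apply: (Qd H x xQ) => y yspan.
suff -> : y = 0 by rewrite raddf0.
apply: (yspan [set 0]).
- split=> [|a z ->]; last by rewrite /lact /ract !rep0.
  by split=> // c z z' -> ->; rewrite scaler0 addr0.
- exact: closed_set0.
- by move=> z zc; apply: contrapT => z0; apply: (Hc z).
Qed.

End KazhdanConstants.

Theorem theorem3p4 (R : realType) (A : cstarType R) (D : cstar_double A)
    (H K : bimodule D)
    (hH : universal_bimodule H) (hK : standard_bimodule K)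
    (t_u := kazhdan_sup (central H))
    (t_c := kazhdan_sup (central_span H))
    (t_s := kazhdan_sup (central K)) :
  [/\ (* (a) *)
      ((0 < t_u)%E <-> strong_property_T D) /\
      (strong_property_T D <->
        exists (Q : {fset A}) (delta : R), [/\ Q != fset0, 0 < delta &
          forall xi, almost_central H Q delta xi -> proj_central xi <> 0]),
      (* (b) *)
      ((0 < t_s)%E <->
        forall eps : R, 0 < eps ->
        exists (Q : {fset A}) (delta : R), [/\ Q != fset0, 0 < delta &
          forall H' : bimodule D, quasi_standard_bimodule H' ->
          forall xi, almost_central H' Q delta xi ->
            hnorm (xi - proj_central xi) < eps]) /\
      ((0 < t_s)%E <->
        exists (Q : {fset A}) (delta : R), [/\ Q != fset0, 0 < delta &
          forall xi, almost_central K Q delta xi -> proj_central xi <> 0]),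
      (* (c) *)
      [/\ (0 < t_c)%E <-> property_T D,
          (0 < t_c)%E <->
            exists (Q : {fset A}) (delta : R), [/\ Q != fset0, 0 < delta &
              forall H' : bimodule D,
                almost_central H' Q delta `&` orth_compl (central_span H')
                  = set0]
        & (0 < t_c)%E <->
            exists (Q : {fset A}) (delta : R), [/\ Q != fset0, 0 < delta &
              almost_central H Q delta `&` orth_compl (central_span H)
                = set0]]
    & (* (d) *)
      (0 < t_u)%E <-> (0 < t_c)%E /\ (0 < t_s)%E].
Proof.
have u_gap := kazhdan_sup_gt0 (central H).
have s_gap := kazhdan_sup_gt0 (central K).
have c_gap := kazhdan_sup_gt0 (central_span H).
have strong : (0 < t_u)%E -> strong_property_T D.
  move=> /u_gap[Q [t [Q0 t0 Hgap]]] alpha a0.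
  have [delta d0 close] := gap_proj_central_close D Q t0 a0.
  exists Q, delta; split=> // H' x; apply: close.
  exact: universal_gap hH Hgap.
have strong_proj (L : bimodule D) : strong_property_T D ->
    exists (Q : {fset A}) (delta : R), [/\ Q != fset0, 0 < delta &
      forall xi, almost_central L Q delta xi -> proj_central xi <> 0].
  (* A unit vector at distance less than 1 from its projection has a non-zero projection. *)
  move=> /(_ 1 ltr01)[Q [delta [Q0 d0 close]]].
  exists Q, delta; split=> // x xQ p0.
  by have := close L x xQ; rewrite p0 subr0 xQ.1 ltxx.
have c_span : (0 < t_c)%E ->
    exists (Q : {fset A}) (delta : R), [/\ Q != fset0, 0 < delta &
      forall (H' : bimodule D) x, almost_central H' Q delta x ->
        ~ orth_compl (central_span H') x].
  move=> /c_gap[Q [t [Q0 t0 Hgap]]].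
  have [delta d0 small] := almost_central_small D Q t0.
  exists Q, delta; split=> // H' x xQ xo; have := small H' x xQ.
  rewrite ltNge; have := universal_span_gap hH Hgap xo.
  by rewrite xQ.1 expr1n mulr1 => ->.
have span_c : (exists (Q : {fset A}) (delta : R), [/\ Q != fset0, 0 < delta &
      forall x, almost_central H Q delta x -> ~ orth_compl (central_span H) x]) ->
    (0 < t_c)%E.
  by move=> /gap_almost_central/c_gap.
split.
- split; split=> //.
  + by move=> /strong_proj/gap_proj_neq0/u_gap.
  + exact: strong_proj.
  + by move=> /gap_proj_neq0/u_gap/strong.
- split; split.
  + move=> /s_gap[Q [t [Q0 t0 Kgap]]] eps e0.
    have [delta d0 close] := gap_proj_central_close D Q t0 e0.
    exists Q, delta; split=> // H' H'qs x; apply: close => y yc.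
    apply: (central_span_gap hK Kgap); split=> //.
    exact: quasi_standard_central_span.
  + move=> close; apply/s_gap/gap_proj_neq0.
    have [Q [delta [Q0 d0 closeQ]]] := close 1 ltr01.
    exists Q, delta; split=> // x xQ p0.
    have := closeQ K (standard_quasi_standard hK) x xQ.
    by rewrite p0 subr0 xQ.1 ltxx.
  + by move=> /s_gap/gap_proj_neq0.
  + by move=> /gap_proj_neq0/s_gap.
- have set0E (H' : bimodule D) Q (delta : R) :
      almost_central H' Q delta `&` orth_compl (central_span H') = set0 <->
      forall x, almost_central H' Q delta x -> ~ orth_compl (central_span H') x.
    split=> [E0 x xQ xo|Qd]; last by apply/seteqP; split=> // x [/Qd].
    by have : set0 x by rewrite -E0.
  split; split.
  + move=> /c_span[Q [delta [Q0 d0 Qd]]].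
    exact: property_T_of_orth_central_span Q0 d0 Qd.
  + move=> /(property_T_orth_central_span hH)[Q [delta [Q0 d0 Qd]]].
    by apply: span_c; exists Q, delta; split=> // x; apply: Qd.
  + move=> /c_span[Q [delta [Q0 d0 Qd]]]; exists Q, delta; split=> // H'.
    by apply/set0E => x; apply: Qd.
  + move=> [Q [delta [Q0 d0 Qd]]]; apply: span_c; exists Q, delta; split=> //.
    by apply/set0E; apply: Qd.
  + move=> /c_span[Q [delta [Q0 d0 Qd]]]; exists Q, delta; split=> //.
    by apply/set0E => x; apply: Qd.
  + move=> [Q [delta [Q0 d0 Qd]]]; apply: span_c; exists Q, delta; split=> //.
    exact/set0E.
split=> [/u_gap[Q [t [Q0 t0 Hgap]]]|].
  split; [apply/c_gap|apply/s_gap]; exists Q, t; split=> //.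
    exact: gap_on_sub (@orth_central_span_sub _ _ _ H) Hgap.
  exact: universal_gap hH Hgap.
case=> /c_gap[Qc [tc [Qc0 tc0 cgap]]] /s_gap[Qs [ts [Qs0 ts0 sgap]]].
(* Enlarging [Q] and lowering [t] preserve a gap, so both gaps hold for this common pair; every
   vector of [H] lies in the orthogonal sum of the central span and its complement. *)
apply/u_gap; exists (Qc `|` Qs)%fset, (Num.min tc ts); split=> [||x xc].
- by apply/fset0Pn; have /fset0Pn[a aQ] := Qc0; exists a; rewrite inE aQ.
- by rewrite lt_min tc0.
have spanH := central_span_subbimodule H.
have spancl := @central_span_closed _ _ _ H.
have spanHo := subbimodule_orth_compl spanH.
apply: (orth_sum_gap (S1 := central_span H)
  (S2 := orth_compl (central_span H))) => //.
- apply: gap_on_sub (central_span_gap hK sgap) => //.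
    by move=> a aQ; rewrite inE aQ orbT.
  by rewrite ge_min lexx orbT.
- apply: gap_on_sub cgap => [a aQ||y []//].
    by rewrite inE aQ.
  by rewrite ge_min lexx.
- by split=> //; apply: (orth_projP x spanH.1 spancl).2.
Qed.
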